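(* Let $R,L,M>0$. Let $\mu$ be a probability measure on $\mathbb{R}^d$, absolutely continuous with density upper bounded by $M$ and compactly supported in $B_R$, and let $\bar\varphi,\phi$ be convex lower semicontinuous functions on $\mathbb{R}^d$ which are $L$-Lipschitz on $B_{2R}$. Let $q\in[1,2]$ and $$C_{R,d}=4\,\frac{e}{\sqrt{2\pi}\sqrt{\frac d2+1}}\left(\frac{64\pi e}{\frac d2+1}\right)^{\frac d2}48\,d^2(2R)^{d-1}.$$ Case 1: If $$\int\phi(x)+\phi^*(\nabla\bar\varphi(x))-\langle x,\nabla\bar\varphi(x)\rangle\,d\mu(x)>\left(\frac R8\right)^{\frac{q+3}{q+1}}2L\,(MC_{R,d})^{\frac{2}{q+1}},$$ then $$\|\nabla\bar\varphi-\nabla\phi\|_{L^q(\mu)}\le 4\sqrt{\frac LR}\left(\int\phi(x)+\phi^*(\nabla\bar\varphi(x))-\langle x,\nabla\bar\varphi(x)\rangle\,d\mu(x)\right)^{\frac12}+L\left(\frac{32}{RL}\int\phi(x)+\phi^*(\nabla\bar\varphi(x))-\langle x,\nabla\bar\varphi(x)\rangle\,d\mu(x)\right)^{\frac{q+1}{2q}}.$$ Case 2: Otherwise, $$\|\nabla\bar\varphi-\nabla\phi\|_{L^q(\mu)}\le 4\left(L^{q+2}MC_{R,d}\right)^{\frac{1}{q+3}}\left(\int\phi(x)+\phi^*(\nabla\bar\varphi(x))-\langle x,\nabla\bar\varphi(x)\rangle\,d\mu(x)\right)^{\frac{1}{q+3}}.$$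
   Context: $B_R$ is the open Euclidean ball of $\mathbb{R}^d$ centered at $0$ with radius $R$. Convex lower semicontinuous functions are proper and take values in $\mathbb{R}\cup\{+\infty\}$; they are finite on $B_{2R}$ here. $\phi^*(y)=\sup_{x\in\mathbb{R}^d}\langle x,y\rangle-\phi(x)$ is the Legendre-Fenchel conjugate. $\|v\|_{L^q(\mu)}=(\int\|v(x)\|^q d\mu(x))^{1/q}$ with $\|\cdot\|$ the Euclidean norm. *)

(* Defs.v *)
From HB Require Import structures.
From mathcomp Require Import all_boot all_order all_algebra.
From mathcomp Require Import all_classical all_reals all_analysis.
From mathcomp Require Import measurable_realfun ring.

Set Implicit Arguments.
Unset Strict Implicit.
Unset Printing Implicit Defensive.
Import Order.TTheory GRing.Theory Num.Theory.
Import numFieldNormedType.Exports.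

Local Open Scope classical_set_scope.
Local Open Scope ring_scope.

(* Vectors are equipped with the Borel sigma-algebra. *)
Section rV_measurable.
Context (K : realType) (n : nat).

HB.instance Definition _ := @isMeasurable.Build
  (sigma_display (@open 'rV[K]_n)) 'rV[K]_n <<s @open 'rV[K]_n >>
  (@sigma_algebra0 _ _ _) (@sigma_algebraC _ _) (@sigma_algebra_bigcup _ _ _).

End rV_measurable.

Lemma measurable_fun_rVP (K : realType) n d (T : measurableType d)
    (f : T -> 'rV[K]_n) :
  (forall i, measurable_fun setT (fun t => f t ord0 i)) -> measurable_fun setT f.
Proof.
move=> mf; apply: (@measurability _ _ _ _ _ _ (@open 'rV[K]_n)) => //.
move=> _ [U oU <-]; rewrite setTI.
pose box (p : 'rV[rat]_n * nat) : set 'rV[K]_n :=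
  [set x | forall i, `|ratr (p.1 ord0 i) - x ord0 i| < p.2.+1%:R^-1].
pose F p := if pselect (box p `<=` U) then f @^-1` box p else set0.
have -> : f @^-1` U = \bigcup_p F p.
  apply/seteqP; split => [t /= Uft|t [p _]]; last first.
    by rewrite /F; case: pselect => // pU; exact: pU.
  have /nbhs_ballP[e /= e0 eU] : nbhs (f t) U by apply: open_nbhs_nbhs.
  have [k ke] : exists k : nat, k.+1%:R^-1 < e / 2.
    have e20 : 0 < e / 2 by rewrite divr_gt0.
    by have [k _ /(_ k (leqnn k))] := near_infty_natSinv_lt (PosNum e20); exists k.
  have /fin_all_exists[q hq] (i : 'I_n) :
      exists q : rat, `|ratr q - f t ord0 i| < k.+1%:R^-1.
    have k0 : 0 < (k.+1%:R^-1 : K) by rewrite invr_gt0.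
    have : f t ord0 i - k.+1%:R^-1 < f t ord0 i + k.+1%:R^-1.
      by rewrite ltrD2l; apply: lt_trans k0; rewrite oppr_lt0.
    move=> /rat_in_itvoo[q]; rewrite in_itv/= => /andP[q1 q2].
    by exists q; rewrite ltr_distl q1 q2.
  exists (\row_i q i, k) => //; rewrite /F; case: pselect => [_|[]] /=.
    by move=> i; rewrite mxE; exact: hq.
  move=> x /= hx; apply: eU; split => // i j; rewrite !ord1.
  have := hx j; rewrite /= mxE => hxj; have := hq j => hqj.
  rewrite -ball_normE /ball_ /=.
  rewrite (_ : f t _ _ - _ = (ratr (q j) - x ord0 j) - (ratr (q j) - f t ord0 j)).
    apply: (le_lt_trans (ler_normB _ _)); rewrite [e]splitr.
    by apply: ltrD; [exact: lt_trans hxj ke|exact: lt_trans hqj ke].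
  by ring.
apply: countable_bigcupT_measurable => // p; rewrite /F.
case: pselect => [pU|nU]; last exact: measurable0.
rewrite (_ : _ @^-1` _ = \bigcap_(i in setT) [set t | `|ratr (p.1 ord0 i) - f t ord0 i| < p.2.+1%:R^-1]); last first.
  by apply/seteqP; split => t /= h i => [_|]; exact: h.
apply: fin_bigcap_measurable => // i _.
have mg : measurable_fun setT (fun t => `|ratr (p.1 ord0 i) - f t ord0 i|).
  apply: measurableT_comp => //; by apply: measurable_funB; [exact: measurable_cst|exact: mf].
have := mg measurableT `]-oo, p.2.+1%:R^-1[%classic (measurable_itv _).
by rewrite setTI (_ : _ @^-1` _ = [set t | `|ratr (p.1 ord0 i) - f t ord0 i| < p.2.+1%:R^-1]) ?setTI//;
  apply/seteqP; split => t /=; rewrite in_itv.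
Qed.

Lemma measurable_rV_coord (K : realType) n (i : 'I_n) :
  measurable_fun setT (fun x : 'rV[K]_n => x ord0 i).
Proof.
apply: (@measurability _ _ _ _ _ _ (@RGenOpens.G K)).
  exact: RGenOpens.measurableE.
move=> _ [_ [a [b ->]] <-]; rewrite setTI; apply: sub_sigma_algebra.
by apply: open_comp => // x _; exact: coord_continuous.
Qed.

Section lebesgue_rV_step.
Context (K : realType) (n : nat).

(* [measurableTypeR K] is [K] with its Borel sets: it is the type on which
   [lebesgue_measure] is defined. *)
Definition rV_cons (p : measurableTypeR K * 'rV[K]_n) : 'rV[K]_n.+1 :=
  row_mx (const_mx p.1 : 'rV[K]_1) p.2.

Lemma measurable_rV_cons : measurable_fun setT rV_cons.
Proof.
apply: measurable_fun_rVP => i.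
rewrite (_ : (fun _ => _) = (fun p : measurableTypeR K * 'rV[K]_n =>
  match @fintype.split 1 n i with inl _ => p.1 | inr j => p.2 ord0 j end)).
  case: (@fintype.split 1 n i) => j; first exact: measurable_fst.
  exact: (measurableT_comp (measurable_rV_coord j) measurable_snd).
apply/funext => p; rewrite /rV_cons mxE.
by case: (@fintype.split 1 n i) => j //; rewrite mxE.
Qed.

Variable m : {sigma_finite_measure set 'rV[K]_n -> \bar K}.

Definition lebesgue_rV_step : set 'rV[K]_n.+1 -> \bar K :=
  pushforward (lebesgue_measure \x m)%E rV_cons.

Let step0 : lebesgue_rV_step set0 = 0%E.
Proof. by rewrite /lebesgue_rV_step /pushforward preimage_set0 measure0. Qed.

Let step_ge0 A : (0 <= lebesgue_rV_step A)%E.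
Proof. by rewrite /lebesgue_rV_step /pushforward; exact: measure_ge0. Qed.

Let step_sigma_additive : semi_sigma_additive lebesgue_rV_step.
Proof.
move=> F mF tF mUF; rewrite /lebesgue_rV_step /pushforward preimage_bigcup.
have mc A : measurable A -> measurable (rV_cons @^-1` A).
  by move=> mA; rewrite -[X in measurable X]setTI; exact: measurable_rV_cons.
apply: measure_semi_sigma_additive.
- by move=> k; exact: mc.
- apply/trivIsetP => /= i j _ _ ij; rewrite -preimage_setI.
  by move/trivIsetP : tF => /(_ _ _ _ _ ij) ->//; rewrite preimage_set0.
- by rewrite -preimage_bigcup; exact: mc.
Qed.

HB.instance Definition _ := isMeasure.Build _ _ _ lebesgue_rV_step
  step0 step_ge0 step_sigma_additive.

Let step_sigma_finite : sigma_finite setT lebesgue_rV_step.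
Proof.
have /sigma_finiteP[F [TF ndF Foo]] := sigma_finiteT (@lebesgue_measure K).
have /sigma_finiteP[G [TG ndG Goo]] := sigma_finiteT m.
have FGT : \bigcup_k (F k `*` G k) = setT.
  rewrite -subTset => -[x y] _.
  have [i _ Fix] : (\bigcup_k F k) x by rewrite -TF.
  have [j _ Gjy] : (\bigcup_k G k) y by rewrite -TG.
  exists (maxn i j) => //; split.
    by move: x Fix; exact/subsetPset/ndF/leq_maxl.
  by move: y Gjy; exact/subsetPset/ndG/leq_maxr.
pose uncons (x : 'rV[K]_n.+1) : measurableTypeR K * 'rV[K]_n :=
  (lsubmx (x : 'rV[K]_(1 + n)) ord0 ord0, rsubmx (x : 'rV[K]_(1 + n))).
have consK : cancel rV_cons uncons.
  by move=> [a v]; rewrite /uncons /rV_cons row_mxKl row_mxKr mxE.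
have unconsK : cancel uncons rV_cons.
  move=> x; rewrite /uncons /rV_cons /=.
  rewrite (_ : const_mx _ = lsubmx (x : 'rV_(1 + n))) ?hsubmxK//.
  by apply/rowP => i; rewrite [LHS]mxE !ord1.
have muncons : measurable_fun setT uncons.
  apply: measurable_fun_pair.
    rewrite (_ : (fun _ => _) = fun x : 'rV[K]_n.+1 => x ord0 (lshift n (ord0 : 'I_1))).
      exact: measurable_rV_coord.
    by apply/funext => x; rewrite mxE.
  apply: measurable_fun_rVP => i.
  rewrite (_ : (fun _ => _) = fun x : 'rV[K]_n.+1 => x ord0 (rshift 1 i)).
    exact: measurable_rV_coord.
  by apply/funext => x; rewrite mxE.
exists (fun k => uncons @^-1` (F k `*` G k)).
  by rewrite -preimage_bigcup FGT preimage_setT.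
move=> k; have [mF Fkoo] := Foo k; have [mG Gkoo] := Goo k; split.
  by rewrite -[X in measurable X]setTI; apply: muncons => //; exact: measurableX.
rewrite /lebesgue_rV_step /pushforward -comp_preimage.
rewrite (_ : uncons \o rV_cons = id); last by apply/funext => p; exact: consK.
by rewrite preimage_id product_measure1E// lte_mul_pinfty// ge0_fin_numE.
Qed.

HB.instance Definition _ := Measure_isSigmaFinite.Build _ _ _ lebesgue_rV_step
  step_sigma_finite.

End lebesgue_rV_step.

(* Lebesgue measure on the Borel sets of K^n, as an iterated product; it is
   the product of the lengths on boxes, see [lebesgue_rV_box]. *)
Fixpoint lebesgue_rV (K : realType) (n : nat) :
    {sigma_finite_measure set 'rV[K]_n -> \bar K} :=
  match n with
  | 0 => \d_(0 : 'rV[K]_0)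
  | n'.+1 => lebesgue_rV_step (lebesgue_rV K n')
  end.

Lemma lebesgue_rV_box (K : realType) n (A : 'I_n -> set (measurableTypeR K)) :
  (forall i, measurable (A i)) ->
  lebesgue_rV K n [set x | forall i, A i (x ord0 i)]
    = (\prod_(i < n) lebesgue_measure (A i))%E.
Proof.
elim: n A => [|n IHn] A mA.
  rewrite big_ord0 (_ : [set x | _] = setT) /=; first by rewrite diracT.
  by rewrite -subTset => x _ [].
rewrite big_ord_recl/= -IHn//.
have mB : measurable [set x : 'rV[K]_n | forall i, A (lift ord0 i) (x ord0 i)].
  rewrite (_ : [set x | _] =
      \bigcap_(i in setT) ((fun x : 'rV[K]_n => x ord0 i) @^-1` A (lift ord0 i))).
    apply: fin_bigcap_measurable => // i _.
    rewrite -[X in measurable X]setTI.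
    exact: (measurable_rV_coord i measurableT (mA (lift ord0 i))).
  by apply/seteqP; split => x /= h i => [_|]; exact: h.
rewrite -product_measure1E//= /lebesgue_rV_step /pushforward.
congr (product_measure1 _ _ _).
have cons0 (p : measurableTypeR K * 'rV[K]_n) : rV_cons p ord0 ord0 = p.1.
  by rewrite mxE; case: (@fintype.splitP 1 n ord0) => // j _; rewrite mxE.
have consS (p : measurableTypeR K * 'rV[K]_n) i :
    rV_cons p ord0 (lift ord0 i) = p.2 ord0 i.
  rewrite mxE; case: (@fintype.splitP 1 n (lift ord0 i)) => [[[]]//|j].
  by rewrite /= /bump/= => -[/val_inj ->].
apply/seteqP; split => [p /= h|p /= [h0 hS] i].
  by split => [|i]; [rewrite -cons0|rewrite -consS]; exact: h.
by case: (unliftP ord0 i) => [j|] ->; rewrite ?consS ?cons0//; exact: hS.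
Qed.

Section euclidean.
Context (K : realType) (d : nat).
Implicit Types x y : 'rV[K]_d.

Definition dotv x y : K := \sum_(i < d) x ord0 i * y ord0 i.

Definition enorm x : K := Num.sqrt (dotv x x).

(* The library's norm on ['rV[K]_d] is the sup norm, so that [ball 0 r] is a
   cube. *)
Definition eball (r : K) : set 'rV[K]_d := [set x | enorm x < r].

End euclidean.

Section measures.
Context (K : realType) (d : nat).
Implicit Types mu : {measure set 'rV[K]_d -> \bar K}.

Definition msupport mu : set 'rV[K]_d :=
  [set x | forall U, open U -> U x -> (0 < mu U)%E].

Definition has_density_le mu (M : K) : Prop :=
  exists f : 'rV[K]_d -> K,
    [/\ measurable_fun setT f,
        forall x, 0 <= f x,
        {ae lebesgue_rV K d, forall x, f x <= M} &
        forall A, measurable A ->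
          mu A = (\int[lebesgue_rV K d]_(x in A) (f x)%:E)%E].

End measures.

Section convex_functions.
Context (K : realType) (d : nat).
Implicit Types f : 'rV[K]_d -> \bar K.

Definition proper_fun f : Prop :=
  (forall x, -oo < f x)%E /\ (exists x, f x < +oo)%E.

(* The case t = 0 is harmless, since 0 * +oo = 0 in [\bar K]. *)
Definition convex_efun f : Prop :=
  forall (x y : 'rV[K]_d) (t : K), 0 <= t <= 1 ->
    (f (t *: x + (1 - t) *: y)%R <= t%:E * f x + (1 - t)%:E * f y)%E.

Definition convex_lsc f : Prop :=
  [/\ proper_fun f, convex_efun f & lower_semicontinuous f].

Definition lipschitz_on_eball f (r L : K) : Prop :=
  (forall x, eball r x -> f x \is a fin_num) /\
  (forall x y, eball r x -> eball r y ->
    `|fine (f x) - fine (f y)| <= L * enorm (x - y)).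

Definition conjugate f (y : 'rV[K]_d) : \bar K :=
  ereal_sup [set ((dotv x y)%:E - f x)%E | x in [set: 'rV[K]_d]].

(* Outside the set where [f] is finite in a neighbourhood and differentiable,
   the value 0 is a convention. Being differentiable does not depend on the
   norm chosen on ['rV[K]_d]. *)
Definition grad f (x : 'rV[K]_d) : 'rV[K]_d :=
  if `[< (\forall y \near x, f y \is a fin_num) /\
         differentiable (fine \o f) x >]
  then \row_(i < d) 'D_(delta_mx ord0 i) (fine \o f) x
  else 0.

Definition gap (mu : {measure set 'rV[K]_d -> \bar K}) f fbar : \bar K :=
  (\int[mu]_x (f x + conjugate f (grad fbar x)
               - (dotv x (grad fbar x))%:E))%E.

End convex_functions.

Definition C_ (K : realType) (R : K) (d : nat) : K :=
  4 * (expR 1 / (Num.sqrt (2 * pi) * Num.sqrt (d%:R / 2 + 1)))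
    * ((64 * pi * expR 1) / (d%:R / 2 + 1)) `^ (d%:R / 2)
    * 48 * d%:R ^+ 2 * (2 * R) ^+ d.-1.

(* Main.v *)
Require Import Defs.
From HB Require Import structures.
From mathcomp Require Import all_boot all_order all_algebra.
From mathcomp Require Import all_classical all_reals all_analysis.
From mathcomp Require Import measurable_realfun ring lra.
Import Order.TTheory GRing.Theory Num.Theory.
Import numFieldNormedType.Exports.

Set Implicit Arguments.
Unset Strict Implicit.
Unset Printing Implicit Defensive.

Local Open Scope classical_set_scope.
Local Open Scope ring_scope.

(** Notation for this explanation: z = |grad phibar - grad phi|, p = grad phibar x,
    g x = phi x + phi^* p - <x, p>, G is the integral of g against mu, and, for
    a scale eta <= R,
      D_i x = phi (x + eta e_i) + phi (x - eta e_i) - 2 phi x.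

    The function g measures how far p is from being a subgradient of phi at x.
    Testing the supremum that defines phi^* p at the points x + eta e_i and
    x - eta e_i gives, wherever phi is differentiable,
      eta |p_i - d_i phi x| <= g x + D_i x              ([coord_diff_le]),
    so that z <= (d g + sum_i D_i) / eta pointwise.  It remains to see that D_i
    has an integral of order eta ^ 2.  On a line parallel to e_i, the second
    difference is the increment of the eta-increments of phi: its integral over
    the chord cut out by the ball telescopes and only two end pieces of length
    eta survive, where the increments are at most L eta.  Each chord thus
    contributes at most 2 L eta ^ 2 ([integral_second_difference]).  The chords
    are parametrised by the projection of the ball on d - 1 coordinates, whose
    volume is bounded through a Gaussian that majorises its indicator; this
    yields [sdiff_integral_le], with the constant A = [slice_const].

    Letting eta tend to 0 in the same bound shows that D_i = o(eta) along a
    sequence, almost everywhere in the ball.  For a convex function this is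
    differentiability ([grad_convex_slope]), so phi has a gradient, which is a
    subgradient, at almost every point.

    Since z <= 2 L on the ball, the power z ^ q is at most (2 L) ^ (q - 1) z, and for all
    eta in ]0, R]
      |z|_q ^ q <= (2 L) ^ (q - 1) (d G / eta + 2 d M L A eta)
                                             ([gradient_stability_scale]).

    The two cases follow by comparing constants.  The constant C = C_{R,d}
    satisfies 16 d ^ 2 A <= C ([slice_const_le_C]), and M A R >= 1 / 2 because mu
    has mass 1 and lives on the ball ([density_lower_bound]); hence
    M C R >= 8 d ^ 2.  In the first case this forces G > R L / 4, and then
    4 sqrt (L / R) G ^ (1 / 2) already exceeds 2 L, which bounds |z|_q
    ([large_gap_bound]).  In the second case put w = M C G / L.  If w >= 1 / 16
    the right-hand side again exceeds 2 L; otherwise eta = d sqrt w / (M C)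
    is an admissible scale, and it gives
    |z|_q ^ q <= (2 L) ^ q sqrt w <= (4 L w ^ (1 / (q + 3))) ^ q, where
    L w ^ (1 / (q + 3)) = (L ^ (q + 2) M C G) ^ (1 / (q + 3))
    ([small_gap_bound]). *)

(** * Second differences on the line *)

Lemma lebesgue_integral_shift (K : realType) (f : K -> \bar K)
    (c : K) :
  measurable_fun setT f -> (forall t, (0 <= f t)%E) ->
  (\int[lebesgue_measure]_t f (t + c)%R = \int[lebesgue_measure]_t f t)%E.
Proof.
move=> mf f0.
have ms : measurable_fun setT ((fun t : K => t + c) : _ -> measurableTypeR K).
  by apply: measurable_funD.
rewrite -[LHS](@ge0_integral_pushforward _ _ (measurableTypeR K)
  (measurableTypeR K) K _ ms lebesgue_measure setT f)//.
apply: eq_measure_integral => A mA _; apply/esym.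
apply: (@lebesgue_measure_unique K (pushforward lebesgue_measure
  ((fun t : K => t + c) : _ -> measurableTypeR K))) => // _ [[a b] _ <-].
transitivity (@lebesgue_measure K `](a - c), (b - c)]); last first.
  congr lebesgue_measure; apply/seteqP.
  by split => t /=; rewrite !in_itv/= ltrBlDr lerBrDr.
rewrite !lebesgue_measure_itv/= !lte_fin ltrD2r.
by case: ifP => // _; rewrite -!EFinB; congr EFin; ring.
Qed.

(** With k t = psi (t + eta) - psi t + B, the second difference is
    k t - k (t - eta), so its integral over ]-a, a[ is the difference of the
    integrals of k over ]-a, a[ and ]-a - eta, a - eta[.  The first interval
    exceeds the second one by at most [a - eta, a[, where 0 <= k <= 2 B.  Adding B
    makes k nonnegative on the whole range, so that only nonnegative integrals
    have to be split and translated. *)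
Lemma integral_second_difference (K : realType) (psi : K -> K)
    (a eta B : K) :
  measurable_fun setT psi -> 0 <= eta -> 0 <= B ->
  (forall s, - (a + eta) < s < a -> `|psi (s + eta) - psi s| <= B) ->
  (forall s, - a < s < a -> 0 <= psi (s + eta) + psi (s - eta) - 2 * psi s) ->
  (\int[lebesgue_measure]_(t in `](- a)%R, a[)
     (psi (t + eta) + psi (t - eta) - 2 * psi t)%R%:E <= (2 * B * eta)%R%:E)%E.
Proof.
move=> mpsi eta0 B0 Bpsi D0.
have [a0|a0] := leP a 0.
  rewrite set_itv_ge; first by rewrite integral_set0 lee_fin !mulr_ge0.
  by rewrite -leNgt bnd_simp; lra.
pose k (t : K) := psi (t + eta) - psi t + B.
have ms (c : K) : measurable_fun setT (fun t : K => psi (t + c)).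
  apply: (measurableT_comp mpsi); exact: measurable_funD.
have mk : measurable_fun setT k.
  by apply: measurable_funD => //; apply: measurable_funB.
have k0 t : - (a + eta) < t < a -> 0 <= k t.
  by move=> /Bpsi; rewrite ler_norml /k; lra.
have k2 t : - (a + eta) < t < a -> k t <= 2 * B.
  by move=> /Bpsi; rewrite ler_norml /k; lra.
set lam := @lebesgue_measure K.
pose X := (\int[lam]_(t in `](- a - eta)%R, (a - eta)%R[) (k t)%:E)%E.
have mX : measurable_fun setT (EFin \o k) by exact/measurable_EFinP.
have sX (A : set K) : measurable_fun A (EFin \o k) by exact: measurable_funTS.
have X0 : (0 <= X)%E.
  by apply: integral_ge0 => t /=; rewrite in_itv/= lee_fin => /andP[? ?];
    apply: k0; lra.
have Xfin : X \is a fin_num.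
  rewrite ge0_fin_numE//; apply: (@le_lt_trans _ _
    (\int[lam]_(t in `](- a - eta)%R, (a - eta)%R[) (cst (2 * B)%R%:E t)))%E.
    apply: ge0_le_integral => //=.
    - by move=> t /=; rewrite in_itv/= lee_fin => /andP[? ?]; apply: k0; lra.
    - exact: sX.
    - by move=> t /=; rewrite lee_fin in_itv/= => /andP[? ?]; apply: k2; lra.
  rewrite integral_cst//= lebesgue_measure_itv/=.
  by case: ifP => _; rewrite ?mule0 -?EFinB -?EFinM ltry.
have shiftX : (\int[lam]_(t in `](- a)%R, a[) (k (t - eta)%R)%:E = X)%E.
  rewrite /X integral_mkcond [RHS]integral_mkcond.
  rewrite -[RHS](@lebesgue_integral_shift K _ (- eta)).
  - apply: eq_integral => t _; rewrite !patchE !mem_setE !in_itv/=.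
    by rewrite ltrBlDr subrK ltrBDr subrK.
  - by apply/measurable_restrict; [exact: measurable_itv|exact:
    measurableT|rewrite setTI].
  - by move=> t; rewrite patchE; case: ifPn => //;
    rewrite mem_setE in_itv/= lee_fin => /andP[? ?]; apply: k0; lra.
have split1 : (\int[lam]_(t in `](- a)%R, a[) (k t)%:E =
    \int[lam]_(t in `](- a)%R, a[) (psi (t + eta) + psi (t - eta) - 2 *
      psi t)%R%:E + X)%E.
  rewrite -shiftX -ge0_integralD//=.
  - by apply: eq_integral => t _; rewrite -EFinD /k; congr EFin;
    rewrite subrK; ring.
  - apply/measurable_EFinP; apply: measurable_funTS; apply: measurable_funB.
      by apply: measurable_funD; exact: ms.
    by apply: measurable_funM.
  - by move=> t /=; rewrite in_itv/= lee_fin => /andP[? ?]; apply: k0; lra.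
  - apply/measurable_EFinP; apply: measurable_funTS;
    apply: (measurableT_comp mk).
    exact: measurable_funD.
have split2 : (\int[lam]_(t in `](- a)%R, a[) (k t)%:E <= X + (2 * B *
  eta)%R%:E)%E.
  apply: (@le_trans _ _ (\int[lam]_(t in `](- a - eta)%R, a[) (k t)%:E)%E).
    apply: ge0_subset_integral => //=.
    - exact: sX.
    - by move=> t /=; rewrite in_itv/= lee_fin => /andP[? ?]; apply: k0; lra.
    - by move=> t /=; rewrite !in_itv/= => /andP[? ?]; apply/andP; lra.
  rewrite (_ : `](- a - eta)%R, a[%classic = `](- a - eta)%R,
    (a - eta)%R[%classic `|` `[(a - eta)%R, a[%classic); last first.
    apply/seteqP; split => t /=; rewrite !in_itv/=.
      move=> /andP[ta tb]; case: (ltP t (a - eta)) => h; [left|right]; lra.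
    by case => /andP[? ?]; apply/andP; lra.
  rewrite ge0_integral_setU//=; last 3 first.
  - exact: sX.
  - by move=> t /=; rewrite !in_itv/= lee_fin => -[|] /andP[? ?]; apply: k0;
    lra.
  - rewrite disj_set2E; apply/eqP/seteqP; split => t //=;
    rewrite !in_itv/= => -[/andP[? ?] /andP[? ?]]; lra.
  apply: leeD => //.
  apply: (@le_trans _ _ (\int[lam]_(t in `[(a - eta)%R, a[) (cst (2 *
    B)%R%:E t)))%E.
    apply: ge0_le_integral => //=.
    - by move=> t /=; rewrite in_itv/= lee_fin => /andP[? ?]; apply: k0; lra.
    - exact: sX.
    - by move=> t /=; rewrite lee_fin in_itv/= => /andP[? ?]; apply: k2; lra.
  rewrite integral_cst//= lebesgue_measure_itv/=.
  case: ifP => _; rewrite ?mule0 -?EFinB -?EFinM lee_fin ?mulr_ge0//.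
  by rewrite opprB addrC subrK.
by move: split2; rewrite split1 addeC leeD2lE.
Qed.

(** * Integration along the lines of a coordinate direction *)

Definition upd (K : realType) n (x : 'rV[K]_n) (i : 'I_n) (t : K) : 'rV[K]_n :=
  \row_j (if j == i then t else x ord0 j).

Lemma rV_cons_ord0 (K : realType) n (t : K) (y : 'rV[K]_n) :
  rV_cons (t, y) ord0 ord0 = t.
Proof. by rewrite mxE; case: (@fintype.splitP 1 n ord0) => // j _;
  rewrite mxE. Qed.

Lemma rV_cons_lift (K : realType) n (t : K) (y : 'rV[K]_n) i :
  rV_cons (t, y) ord0 (lift ord0 i) = y ord0 i.
Proof.
rewrite mxE; case: (@fintype.splitP 1 n (lift ord0 i)) => [[[]]//|j].
by rewrite /= /bump/= => -[/val_inj ->].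
Qed.

Lemma upd_rV_cons0 (K : realType) n (t s : K) (y : 'rV[K]_n) :
  upd (rV_cons (t, y)) ord0 s = rV_cons (s, y).
Proof.
apply/rowP => j; rewrite [LHS]mxE; case: (unliftP ord0 j) => [i|] ->.
  by rewrite !rV_cons_lift.
by rewrite eqxx rV_cons_ord0.
Qed.

Lemma upd_rV_consS (K : realType) n (t s : K) (y : 'rV[K]_n) i :
  upd (rV_cons (t, y)) (lift ord0 i) s = rV_cons (t, upd y i s).
Proof.
apply/rowP => j; rewrite [LHS]mxE; case: (unliftP ord0 j) => [k|] ->.
  by rewrite !rV_cons_lift mxE (inj_eq lift_inj).
by rewrite !rV_cons_ord0.
Qed.

Section tonelli.
Context (K : realType) (n : nat).
Variable F : 'rV[K]_n.+1 -> \bar K.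
Hypotheses (mF : measurable_fun setT F) (F0 : forall x, (0 <= F x)%E).

Let mFc : measurable_fun setT (F \o @rV_cons K n).
Proof. exact: measurableT_comp mF (@measurable_rV_cons K n). Qed.

Lemma lebesgue_rV_tonelli1 :
  (\int[lebesgue_rV K n.+1]_x F x =
   \int[lebesgue_measure]_t \int[lebesgue_rV K n]_y F (rV_cons (t, y)))%E.
Proof.
rewrite /= /lebesgue_rV_step ge0_integral_pushforward//; last first.
  exact: measurable_rV_cons.
by rewrite preimage_setT fubini_tonelli1// => z /=.
Qed.

Lemma lebesgue_rV_tonelli2 :
  (\int[lebesgue_rV K n.+1]_x F x =
   \int[lebesgue_rV K n]_y \int[lebesgue_measure]_t F (rV_cons (t, y)))%E.
Proof.
rewrite /= /lebesgue_rV_step ge0_integral_pushforward//; last first.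
  exact: measurable_rV_cons.
by rewrite preimage_setT fubini_tonelli2// => z /=.
Qed.

Lemma measurable_lebesgue_rV_section2 (t : K) :
  measurable_fun setT (fun y => F (rV_cons (t, y))).
Proof. by apply: (measurableT_comp mFc); exact: measurable_pair1. Qed.

Lemma measurable_lebesgue_rV_integral2 :
  measurable_fun setT (fun t : measurableTypeR K =>
    \int[lebesgue_rV K n]_y F (rV_cons (t, y)))%E.
Proof.
by apply: (@measurable_fun_fubini_tonelli_F _ _ _ _ _ (lebesgue_rV K n) (F \o
  @rV_cons K n)) => // z /=.
Qed.

Lemma measurable_lebesgue_rV_integral1 :
  measurable_fun setT (fun y => \int[lebesgue_measure]_t F (rV_cons (t, y)))%E.
Proof.
by apply: (@measurable_fun_fubini_tonelli_G _ _ _ _ _ (@lebesgue_measure K) (F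
  \o @rV_cons K n)) => // z /=.
Qed.

End tonelli.

Section product_weight.
Context (K : realType) (w : K -> K) (W : K).
Hypotheses (mw : measurable_fun setT w) (w0 : forall t, 0 <= w t).
Hypothesis intw : (\int[lebesgue_measure]_t (w t)%:E = W%:E)%E.

Lemma measurable_prod_weight n (P : pred 'I_n) :
  measurable_fun setT (fun x : 'rV[K]_n => \prod_(j < n | P j) w (x ord0 j)).
Proof.
rewrite (_ : (fun _ => _) = (fun x : 'rV[K]_n =>
  \prod_(j <- [seq j <- index_enum 'I_n | P j]) w (x ord0 j))).
  by apply: measurable_prod => j _; apply: (measurableT_comp mw);
    exact: measurable_rV_coord.
by apply/funext => x; rewrite big_filter.
Qed.

Lemma integral_prod_weight n :
  (\int[lebesgue_rV K n]_x (\prod_(j < n) w (x ord0 j))%:E = (W ^+ n)%:E)%E.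
Proof.
elim: n => [|n IHn].
  under eq_integral do rewrite big_ord0.
  by rewrite integral_cst//= diracT mule1 expr0.
rewrite lebesgue_rV_tonelli1; last 2 first.
- apply/measurable_EFinP; exact: measurable_prod_weight.
- by move=> x; rewrite lee_fin prodr_ge0.
transitivity (\int[lebesgue_measure]_t ((W ^+ n)%:E * (w t)%:E))%E.
  apply: eq_integral => t _; rewrite muleC -IHn -ge0_integralZl//=.
  - apply: eq_integral => y _; rewrite big_ord_recl rV_cons_ord0 -EFinM.
    by congr (_ * _)%:E; apply: eq_bigr => j _; rewrite rV_cons_lift.
  - by apply/measurable_EFinP; exact: measurable_prod_weight.
  - by move=> y _; rewrite lee_fin prodr_ge0.
  - by rewrite lee_fin.
rewrite ge0_integralZl//=.
- by rewrite intw -EFinM -exprSr.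
- exact/measurable_EFinP.
- by move=> t _; rewrite lee_fin.
- by rewrite lee_fin exprn_ge0// -lee_fin -intw integral_ge0// => t _;
  rewrite lee_fin.
Qed.

(** Fubini for the i-th coordinate: when the integral of F
    along each line parallel to the i-th axis is dominated by
    c times a product weight in the other coordinates, these coordinates integrate
    out to W ^ (n - 1).  The induction peels off the first coordinate: it is the
    line itself if i = 0, and otherwise its weight is absorbed in c. *)
Lemma line_integral_le n (i : 'I_n) (F : 'rV[K]_n -> \bar K) (c : K) :
  measurable_fun setT F -> (forall x, (0 <= F x)%E) -> 0 <= c ->
  (forall x, (\int[lebesgue_measure]_t F (upd x i t) <=
     (c * \prod_(j < n | j != i) w (x ord0 j))%:E)%E) ->
  (\int[lebesgue_rV K n]_x F x <= (c * W ^+ n.-1)%:E)%E.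
Proof.
have W0 : 0 <= W by rewrite -lee_fin -intw integral_ge0// => t _;
  rewrite lee_fin.
elim: n i F c => [[]//|n IHn] i F c mF F0 c0 Fle.
case: (unliftP ord0 i) Fle => [j|] -> Fle.
  rewrite lebesgue_rV_tonelli1//.
  apply: (@le_trans _ _ (\int[lebesgue_measure]_t ((c * W ^+ n.-1)%:E *
    (w t)%:E))%E).
    apply: ge0_le_integral => //=.
    - by move=> t _; apply: integral_ge0.
    - exact: measurable_lebesgue_rV_integral2.
    - apply/measurable_EFinP; exact: measurable_funM.
    - move=> t _; rewrite -EFinM mulrAC; apply: (IHn j) => //.
      + exact: measurable_lebesgue_rV_section2.
      + by rewrite mulr_ge0.
      + move=> y; have := Fle (rV_cons (t, y)).
        under eq_integral do rewrite upd_rV_consS.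
        move=> /le_trans; apply; rewrite lee_fin -mulrA ler_wpM2l//.
        rewrite big_mkcond big_ord_recl neq_lift rV_cons_ord0 ler_wpM2l//.
        rewrite [leRHS]big_mkcond le_eqVlt; apply/orP; left; apply/eqP.
        by apply: eq_bigr => k _; rewrite (inj_eq lift_inj) rV_cons_lift.
  rewrite ge0_integralZl//=.
  - rewrite intw -EFinM -mulrA -exprSr prednK// (leq_trans _ (ltn_ord j))//.
  - exact/measurable_EFinP.
  - by move=> t _; rewrite lee_fin.
  - by rewrite lee_fin mulr_ge0// exprn_ge0.
rewrite lebesgue_rV_tonelli2//.
apply: (@le_trans _ _ (\int[lebesgue_rV K n]_y (c%:E *
  (\prod_(j < n) w (y ord0 j))%:E))%E).
  apply: ge0_le_integral => //=.
  - by move=> y _; apply: integral_ge0.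
  - exact: measurable_lebesgue_rV_integral1.
  - by apply/measurable_EFinP; apply: measurable_funM => //;
    exact: measurable_prod_weight.
  - move=> y _; have := Fle (rV_cons (0, y)).
    under eq_integral do rewrite upd_rV_cons0.
    move=> /le_trans; apply; rewrite -EFinM lee_fin ler_wpM2l//.
    rewrite big_mkcond big_ord_recl eqxx /= mul1r le_eqVlt; apply/orP; left;
      apply/eqP.
    by apply: eq_bigr => k _; rewrite rV_cons_lift.
rewrite ge0_integralZl//=.
- by rewrite integral_prod_weight.
- by apply/measurable_EFinP; exact: measurable_prod_weight.
- by move=> y _; rewrite lee_fin prodr_ge0.
Qed.

End product_weight.

(** * Euclidean geometry, bounded densities and supports *)

Section geometry.
Context (K : realType) (d : nat).
Implicit Types (x y : 'rV[K]_d) (i : 'I_d).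

Definition evec i : 'rV[K]_d := delta_mx ord0 i.

Lemma dotv_ge0 x : 0 <= dotv x x.
Proof. by apply: sumr_ge0 => i _; rewrite -expr2 sqr_ge0. Qed.

Lemma enorm_ltE x (r : K) : 0 < r -> (enorm x < r) = (dotv x x < r ^+ 2).
Proof.
by move=> r0; rewrite /enorm -[r in LHS]gtr0_norm// -sqrtr_sqr ltr_sqrt//
  exprn_gt0.
Qed.

Lemma enorm_leE x (r : K) : 0 <= r -> (enorm x <= r) = (dotv x x <= r ^+ 2).
Proof.
by move=> r0; rewrite /enorm -[r in LHS]ger0_norm// -sqrtr_sqr ler_sqrt//
  sqr_ge0.
Qed.

Lemma enorm_ge0 x : 0 <= enorm x. Proof. exact: sqrtr_ge0. Qed.

Lemma sqr_enorm x : enorm x ^+ 2 = dotv x x.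
Proof. by rewrite sqr_sqrtr// dotv_ge0. Qed.

Lemma dotvxx_coord x i :
  dotv x x = x ord0 i ^+ 2 + \sum_(j < d | j != i) x ord0 j ^+ 2.
Proof. by rewrite /dotv (bigD1 i)//= expr2; congr +%R;
  apply: eq_bigr => j _. Qed.

Lemma coord_le_enorm x i : `|x ord0 i| <= enorm x.
Proof.
rewrite -ler_sqr ?nnegrE ?enorm_ge0// sqr_enorm (dotvxx_coord x i) real_normK
  ?num_real//.
by rewrite lerDl sumr_ge0// => j _; rewrite sqr_ge0.
Qed.

Lemma enorm_le_sum x : enorm x <= \sum_(i < d) `|x ord0 i|.
Proof.
have S0 : 0 <= \sum_(i < d) `|x ord0 i| by exact: sumr_ge0.
rewrite enorm_leE// expr2 mulr_suml; apply: ler_sum => i _.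
rewrite -expr2 -real_normK ?num_real// expr2 ler_wpM2l//.
by rewrite (bigD1 i)//= lerDl sumr_ge0.
Qed.

Lemma dotvC x y : dotv x y = dotv y x.
Proof. by apply: eq_bigr => i _; rewrite mulrC. Qed.

Lemma dotvDl x y z : dotv (x + y) z = dotv x z + dotv y z.
Proof. by rewrite /dotv -big_split; apply: eq_bigr => i _;
  rewrite mxE mulrDl. Qed.

Lemma dotvZl (c : K) x y : dotv (c *: x) y = c * dotv x y.
Proof. by rewrite /dotv mulr_sumr; apply: eq_bigr => i _;
  rewrite mxE mulrA. Qed.

Lemma dotvBl x y z : dotv (x - y) z = dotv x z - dotv y z.
Proof. by rewrite -scaleN1r dotvDl dotvZl mulN1r. Qed.

Lemma dotv_sqrD x y :
  dotv (x + y) (x + y) = dotv x x + 2 * dotv x y + dotv y y.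
Proof.
rewrite /dotv mulr_sumr -!big_split; apply: eq_bigr => i _ /=.
by rewrite !mxE; ring.
Qed.

Lemma dotv_sqrB x y :
  dotv (x - y) (x - y) = dotv x x - 2 * dotv x y + dotv y y.
Proof.
rewrite /dotv mulr_sumr -sumrN -!big_split; apply: eq_bigr => i _ /=.
by rewrite !mxE; ring.
Qed.

Lemma dotv_evec i y : dotv (evec i) y = y ord0 i.
Proof.
rewrite /dotv (bigD1 i)//= big1 ?addr0; first by rewrite mxE !eqxx mul1r.
by move=> j ji; rewrite mxE (negbTE ji) andbF mul0r.
Qed.

Lemma enormZ (c : K) x : enorm (c *: x) = `|c| * enorm x.
Proof.
rewrite /enorm dotvZl dotvC dotvZl mulrA -expr2 sqrtrM ?sqr_ge0//.
by rewrite sqrtr_sqr.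
Qed.

Lemma enorm_evec i : enorm (evec i) = 1.
Proof. by rewrite /enorm dotv_evec mxE !eqxx sqrtr1. Qed.

(** From the parallelogram identity: |x - y|^2 <= 2 |x|^2 + 2 |y|^2. *)
Lemma enormB_le x y (r : K) : enorm x <= r -> enorm y <= r ->
  enorm (x - y) <= 2 * r.
Proof.
move=> xr yr; have r0 := le_trans (enorm_ge0 x) xr.
rewrite enorm_leE ?mulr_ge0//; move: xr yr; rewrite !enorm_leE// => xr yr.
by have := dotv_ge0 (x + y); rewrite dotv_sqrD dotv_sqrB exprMn; lra.
Qed.

Lemma eball_shift x i (r t : K) : eball r x -> `|t| <= r ->
  eball (2 * r) (x + t *: evec i).
Proof.
rewrite /eball/= => xr tr; have r0 : 0 < r := le_lt_trans (enorm_ge0 x) xr.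
rewrite enorm_ltE ?mulr_gt0//.
rewrite dotv_sqrD -!sqr_enorm enormZ enorm_evec mulr1 [dotv x _]dotvC dotvZl
  dotv_evec.
rewrite real_normK ?num_real//.
have xi : `|x ord0 i| <= r by rewrite (le_trans (coord_le_enorm x i))// ltW.
have h1 : enorm x ^+ 2 < r ^+ 2 by rewrite ltr_sqr ?nnegrE ?enorm_ge0// ltW.
have h2 : t * x ord0 i <= r ^+ 2.
  by rewrite (le_trans (ler_norm _))// normrM expr2 ler_pM.
have h3 : t ^+ 2 <= r ^+ 2 by rewrite -real_normK ?num_real// ler_sqr ?nnegrE//
  ltW.
rewrite exprMn; lra.
Qed.

Lemma continuous_dotvxx : continuous (fun x => dotv x x).
Proof.
rewrite /dotv; apply: continuous_big => // [|i _]; first exact: add_continuous.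
move=> x; apply: (@cvgM _ _ _ (nbhs_filter x)); exact: coord_continuous.
Qed.

Lemma open_eball (r : K) : open (@eball K d r).
Proof.
have [r0|r0] := leP r 0.
  rewrite (_ : eball r = set0); first exact: open0.
  by apply/seteqP; split => x //=; rewrite /eball/= ltNge (le_trans r0
    (enorm_ge0 x)).
rewrite (_ : eball r = (fun x => dotv x x) @^-1` [set t | t < r ^+ 2]).
  by apply: open_comp => [x _|]; [exact: continuous_dotvxx|exact: open_lt].
by apply/seteqP; split => x; rewrite /eball/= enorm_ltE.
Qed.

Lemma measurable_eball (r : K) : measurable (@eball K d r).
Proof. by apply: sub_sigma_algebra; exact: open_eball. Qed.

Lemma measurable_shift (v : 'rV[K]_d) : measurable_fun setT (fun x => x + v).
Proof.
apply: measurable_fun_rVP => i.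
rewrite (_ : (fun _ => _) = fun x => x ord0 i + v ord0 i);
  last by apply/funext => x; rewrite mxE.
by apply: measurable_funD => //; exact: measurable_rV_coord.
Qed.

End geometry.

Section density.
Context (K : realType) (d : nat) (M : K).
Variable mu : {measure set 'rV[K]_d -> \bar K}.
Hypotheses (M0 : 0 <= M) (muM : has_density_le mu M).

Lemma has_density_measure_le (A : set 'rV[K]_d) : measurable A ->
  (mu A <= M%:E * lebesgue_rV K d A)%E.
Proof.
move=> mA; have [f [mf f0 fM muE]] := muM.
rewrite muE// -integral_cst//; apply: ae_ge0_le_integral => //.
- by move=> x _; rewrite lee_fin.
- by apply/measurable_EFinP; exact: measurable_funTS.
- by apply: filterS fM => x fx _; rewrite lee_fin.
Qed.

Lemma has_density_integral_le (F : 'rV[K]_d -> \bar K) (A : set 'rV[K]_d) :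
  measurable A -> measurable_fun A F -> (forall x, A x -> 0 <= F x)%E ->
  (\int[mu]_(x in A) F x <= M%:E * \int[lebesgue_rV K d]_(x in A) F x)%E.
Proof.
move=> mA mF F0; rewrite integral_mkcond [in leRHS]integral_mkcond.
have mFA : measurable_fun setT (F \_ A) by apply/measurable_restrict;
  rewrite ?setTI.
have FA0 x : (0 <= (F \_ A) x)%E by exact: erestrict_ge0.
rewrite (_ : M = (NngNum M0)%:num)// -ge0_integral_mscale//.
apply: ge0_le_measure_integral => // S mS; exact: has_density_measure_le.
Qed.

End density.

(** A point outside the support has a null neighbourhood, hence lies in a
    null box with rational centre and radius 1 / (k + 1); there are countably many
    such boxes. *)
Lemma msupport_null (K : realType) (d : nat)
    (mu : {measure set 'rV[K]_d -> \bar K}) (A : set 'rV[K]_d) :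
  measurable A -> msupport mu `<=` A -> mu (~` A) = 0%E.
Proof.
move=> mA sA.
pose box (p : 'rV[rat]_d * nat) : set 'rV[K]_d :=
  [set x | forall i, `|ratr (p.1 ord0 i) - x ord0 i| < p.2.+1%:R^-1].
pose N p := if pselect (mu (box p) = 0%E) then box p else set0.
have mbox p : measurable (box p).
  rewrite (_ : box p = \bigcap_(i in setT)
      ((fun x : 'rV[K]_d => x ord0 i) @^-1` ball (ratr (p.1 ord0 i) : K)
        p.2.+1%:R^-1)).
    apply: fin_bigcap_measurable => // i _; rewrite -[X in measurable X]setTI.
    by apply: measurable_rV_coord => //; exact: measurable_ball.
  by apply/seteqP; split => x /= h i => [_|]; [exact: h|exact: h].
have mN p : measurable (N p) by rewrite /N; case: pselect => _ /=;
  [exact: mbox|exact: measurable0].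
have N0 p : mu (N p) = 0%E by rewrite /N; case: pselect => [h|_] /=;
  rewrite ?measure0.
have cover : ~` A `<=` \bigcup_p N p.
  move=> x Ax; have : ~ msupport mu x by move=> /sA.
  rewrite /msupport/= -existsNE => -[U /not_implyP[oU /not_implyP[Ux /negP]]].
  rewrite -leNgt => muU.
  have /nbhs_ballP[e /= e0 eU] : nbhs x U by apply: open_nbhs_nbhs.
  have [k ke] : exists k : nat, k.+1%:R^-1 < e / 2.
    have e20 : 0 < e / 2 by rewrite divr_gt0.
    by have [k _ /(_ k (leqnn k))] := near_infty_natSinv_lt (PosNum e20);
      exists k.
  have /fin_all_exists[q hq] (i : 'I_d) :
      exists q : rat, `|ratr q - x ord0 i| < k.+1%:R^-1.
    have k0 : 0 < (k.+1%:R^-1 : K) by rewrite invr_gt0.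
    have : x ord0 i - k.+1%:R^-1 < x ord0 i + k.+1%:R^-1.
      by rewrite ltrD2l; apply: lt_trans k0; rewrite oppr_lt0.
    move=> /rat_in_itvoo[q]; rewrite in_itv/= => /andP[q1 q2].
    by exists q; rewrite ltr_distl q1 q2.
  exists (\row_i q i, k) => //; rewrite /N; case: pselect => [_|[]] /=.
    by move=> i; rewrite mxE; exact: hq.
  apply/eqP; rewrite eq_le measure_ge0 andbT (le_trans _ muU)//
    le_measure ?inE//.
    exact: sub_sigma_algebra.
  move=> y /= hy; apply: eU; split => // i j; rewrite !ord1.
  have := hy j; rewrite /= mxE => hxj; have := hq j => hqj.
  rewrite -ball_normE /ball_ /=.
  rewrite (_ : x _ _ - _ = (ratr (q j) - y ord0 j) - (ratr (q j) - x ord0 j));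
    last by ring.
  apply: (le_lt_trans (ler_normB _ _)); rewrite [e]splitr.
  by apply: ltrD; [exact: lt_trans hxj ke|exact: lt_trans hqj ke].
have cN : mu.-negligible (\bigcup_p N p).
  rewrite (_ : \bigcup_p N p = \bigcup_n (if unpickle n is Some p then N p else
    set0)).
    apply: negligible_bigcup => n; case: unpickle => [p|];
      last exact: negligible_set0.
    by apply/negligibleP => //; exact: N0.
  apply/seteqP; split => [x [p _ Np]|x [n _]].
    by exists (pickle p) => //; rewrite pickleK.
  by case: unpickle => // p Np; exists p.
apply/negligibleP; first exact: measurableC.
exact: negligibleS cN.
Qed.

(** * Gaussian majorants and second differences on a ball *)

Section gaussian_weight.
Context (K : realType) (d : nat) (R : K).
Hypothesis R0 : 0 < R.

Let s : K := R / Num.sqrt (d%:R + 2).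
(** The integral of [gauss_weight].  The variance R ^ 2 / (d + 2) makes the
    majorant of [gauss_weight_large] cost expR ((d + 2) / 2), which is how the
    power of e / (d / 2 + 1) of the constant C_{R,d} arises. *)
Definition gauss_mass : K := Num.sqrt (R ^+ 2 * (2 * pi / (d%:R + 2))).
Definition gauss_weight (t : K) : K := expR (- t ^+ 2 * ((d%:R + 2) / (2 *
  R ^+ 2))).

Let d2 : 0 < d%:R + 2 :> K. Proof. by rewrite ltr_wpDl. Qed.

Let s0 : s != 0.
Proof. by rewrite mulf_neq0 ?invr_neq0 ?gt_eqF// sqrtr_gt0. Qed.

Let s2 : s ^+ 2 = R ^+ 2 / (d%:R + 2).
Proof. by rewrite exprMn exprVn sqr_sqrtr// ltW. Qed.

Lemma measurable_gauss_weight : measurable_fun setT gauss_weight.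
Proof.
apply: measurableT_comp => //; apply: measurable_funM => //.
by apply: measurableT_comp => //; exact: measurable_funX.
Qed.

Lemma gauss_weight_ge0 t : 0 <= gauss_weight t.
Proof. exact: expR_ge0. Qed.

Lemma gauss_mass_ge0 : 0 <= gauss_mass. Proof. exact: sqrtr_ge0. Qed.

Lemma integral_gauss_weight :
  (\int[lebesgue_measure]_t (gauss_weight t)%:E = gauss_mass%:E)%E.
Proof.
have gE t : normal_pdf 0 s t = gauss_mass^-1 * gauss_weight t.
  rewrite normal_pdfE// /normal_peak /normal_fun; congr (_ * _).
    by rewrite /gauss_mass s2; congr (_^-1); congr Num.sqrt;
      rewrite -mulr_natr; ring.
  rewrite /gauss_weight subr0 s2; congr expR; field.
  by rewrite (gt_eqF R0) (gt_eqF d2).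
have G0 : 0 < gauss_mass.
  by rewrite sqrtr_gt0 mulr_gt0 ?exprn_gt0// divr_gt0// mulr_gt0// pi_gt0.
have := @integral_normal_pdf K 0 s.
under eq_integral do rewrite gE EFinM.
rewrite ge0_integralZl//=; last 3 first.
- by apply/measurable_EFinP; exact: measurable_gauss_weight.
- by move=> t _; rewrite lee_fin gauss_weight_ge0.
- by rewrite lee_fin invr_ge0 gauss_mass_ge0.
move=> /(congr1 (fun z => gauss_mass%:E * z)%E).
by rewrite muleA -EFinM divff ?gt_eqF// mul1e mule1.
Qed.

Lemma prod_gauss_weight n (P : pred 'I_n) (x : 'I_n -> K) :
  \prod_(j < n | P j) gauss_weight (x j) =
  expR (- (\sum_(j < n | P j) x j ^+ 2) * ((d%:R + 2) / (2 * R ^+ 2))).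
Proof. by rewrite -expR_sum -sumrN mulr_suml. Qed.

(** The product weight, rescaled, majorises the indicator of the ball of
    radius R, in every subset of the coordinates. *)
Lemma gauss_weight_large n (P : pred 'I_n) (x : 'I_n -> K) :
  \sum_(j < n | P j) x j ^+ 2 <= R ^+ 2 ->
  1 <= expR ((d%:R + 2) / 2) * \prod_(j < n | P j) gauss_weight (x j).
Proof.
move=> xR; rewrite prod_gauss_weight -expRD -[leLHS]expR0 ler_expR mulNr
  subr_ge0.
rewrite [leRHS](_ : _ = R ^+ 2 * ((d%:R + 2) / (2 * R ^+ 2))); last first.
  by field; rewrite gt_eqF.
by rewrite ler_wpM2r// divr_ge0 ?ltW// mulr_gt0// exprn_gt0.
Qed.

End gaussian_weight.

(** An upper bound for the volume of the projection of the ball of radius R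
    along a coordinate axis: the mass in d - 1 coordinates of the Gaussian majorant
    of [gauss_weight_large]. *)
Definition slice_const (K : realType) d (R : K) : K :=
  expR ((d%:R + 2) / 2) * gauss_mass d R ^+ d.-1.

Lemma slice_const_ge0 (K : realType) d (R : K) : 0 <= slice_const d R.
Proof. by rewrite mulr_ge0 ?expR_ge0 ?exprn_ge0 ?gauss_mass_ge0. Qed.

Lemma lebesgue_eball_le (K : realType) d (R : K) : 0 < R ->
  (lebesgue_rV K d (@eball K d R) <=
     (expR ((d%:R + 2) / 2) * gauss_mass d R ^+ d)%:E)%E.
Proof.
move=> R0; have mB := @measurable_eball K d R.
rewrite EFinM -(integral_prod_weight (@measurable_gauss_weight K d R)
  (@gauss_weight_ge0 K d R) (integral_gauss_weight d R0)).
have mG : measurable_fun setT (fun x : 'rV[K]_d =>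
  (\prod_(j < d) gauss_weight d R (x ord0 j))%:E).
  apply/measurable_EFinP; apply: measurable_prod_weight.
  exact: measurable_gauss_weight.
have G0 (x : 'rV[K]_d) : (0 <= (\prod_(j < d) gauss_weight d R (x ord0
  j))%:E)%E.
  by rewrite lee_fin prodr_ge0// => j _; exact: gauss_weight_ge0.
rewrite -ge0_integralZl//=.
rewrite -[leLHS]mul1e -integral_cst//.
apply: (@le_trans _ _ (\int[lebesgue_rV K d]_(x in eball R)
   ((expR ((d%:R + 2) / 2))%:E * (\prod_(j < d) gauss_weight d R (x ord0
     j))%:E))%E).
  apply: ge0_le_integral => //=.
  - by apply: measurable_funTS; exact: measurable_funeM.
  - move=> x; rewrite /eball/= enorm_ltE// => xR; rewrite -EFinM lee_fin.
    apply: gauss_weight_large => //; rewrite (le_trans _ (ltW xR))//.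
apply: ge0_subset_integral => //.
- exact: measurable_funeM.
- by move=> x _; rewrite mule_ge0// lee_fin expR_ge0.
Qed.

Section second_difference.
Context (K : realType) (d : nat).

Definition sdiff (f : 'rV[K]_d -> K) i (eta : K) (x : 'rV[K]_d) : K :=
  f (x + eta *: evec K i) + f (x - eta *: evec K i) - 2 * f x.

Lemma updD (x : 'rV[K]_d) i (t s : K) : upd x i t + s *: evec K i =
  upd x i (t + s).
Proof.
apply/rowP => j; rewrite !mxE eqxx /=; case: eqVneq => _;
  first by rewrite mulr1.
by rewrite mulr0 addr0.
Qed.

Lemma dotv_upd (x : 'rV[K]_d) i (t : K) :
  dotv (upd x i t) (upd x i t) = t ^+ 2 + \sum_(j < d | j != i) x ord0 j ^+ 2.
Proof.
rewrite (dotvxx_coord _ i) mxE eqxx; congr +%R.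
by apply: eq_bigr => j /negbTE ji; rewrite mxE ji.
Qed.

Lemma measurable_upd (x : 'rV[K]_d) i : measurable_fun setT (fun t : K =>
  upd x i t).
Proof.
apply: measurable_fun_rVP => j.
rewrite (_ : (fun _ => _) = fun t : K => if j == i then t else x ord0 j).
  by case: eqP.
by apply/funext => t; rewrite mxE.
Qed.

Lemma measurable_sdiff f i (eta : K) :
  measurable_fun setT f -> measurable_fun setT (sdiff f i eta).
Proof.
move=> mf; apply: measurable_funB; last exact: measurable_funM.
by apply: measurable_funD; apply: (measurableT_comp mf);
  exact: measurable_shift.
Qed.

(** The line through x parallel to the i-th axis meets the ball in the chord
    ]-a, a[ with a ^ 2 = R ^ 2 - r2, where r2 is the squared norm of the other
    coordinates.  [integral_second_difference] bounds its contribution by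
    2 L eta ^ 2, and chords exist only for r2 < R ^ 2, where the Gaussian
    majorant of the projection is at least 1. *)
Lemma sdiff_integral_le (f : 'rV[K]_d -> K) i (R L eta : K) :
  0 < R -> 0 <= L -> 0 <= eta <= R -> measurable_fun setT f ->
  (forall x y, eball (2 * R) x -> eball (2 * R) y ->
     `|f x - f y| <= L * enorm (x - y)) ->
  (forall x, eball R x -> 0 <= sdiff f i eta x) ->
  (\int[lebesgue_rV K d]_(x in eball R) (sdiff f i eta x)%:E <=
     (2 * L * eta ^+ 2 * slice_const d R)%:E)%E.
Proof.
move=> R0 L0 /andP[eta0 etaR] mf fL D0.
have mB := @measurable_eball K d R.
rewrite integral_mkcond.
have -> : 2 * L * eta ^+ 2 * slice_const d R =
    2 * L * eta ^+ 2 * expR ((d%:R + 2) / 2) * gauss_mass d R ^+ d.-1.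
  by rewrite /slice_const !mulrA.
apply: (line_integral_le (@measurable_gauss_weight K d R)
  (@gauss_weight_ge0 K d R) (integral_gauss_weight d R0) (i := i)).
- apply/measurable_restrict => //; rewrite setTI; apply: measurable_funTS.
  by apply/measurable_EFinP; exact: measurable_sdiff.
- move=> x; rewrite patchE; case: ifPn => //; rewrite inE => xB.
  by rewrite lee_fin D0.
- by rewrite mulr_ge0 ?expR_ge0// mulr_ge0 ?sqr_ge0// mulr_ge0.
move=> x; set r2 := \sum_(j < d | j != i) x ord0 j ^+ 2.
have r20 : 0 <= r2 by apply: sumr_ge0 => j _; exact: sqr_ge0.
have [r2R|r2R] := leP (R ^+ 2) r2.
  rewrite integral0_eq.
    rewrite lee_fin mulr_ge0//; last by rewrite prodr_ge0// => j _;
      exact: gauss_weight_ge0.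
    by rewrite mulr_ge0 ?expR_ge0// mulr_ge0 ?sqr_ge0// mulr_ge0.
  move=> t _; rewrite patchE ifF//; apply/negbTE;
    rewrite notin_setE /eball/= enorm_ltE//.
  by rewrite dotv_upd -/r2; apply/negP; rewrite -leNgt (le_trans r2R)//
    lerDr sqr_ge0.
pose a := Num.sqrt (R ^+ 2 - r2).
have a0 : 0 < a by rewrite sqrtr_gt0 subr_gt0.
have a2 : a ^+ 2 = R ^+ 2 - r2 by rewrite sqr_sqrtr// subr_ge0 ltW.
have aR : a <= R by rewrite -ler_sqr ?nnegrE ?(ltW a0) ?(ltW R0)// a2; lra.
have inB t : eball R (upd x i t) = (- a < t < a) :> Prop.
  rewrite /eball/= enorm_ltE// dotv_upd -/r2; congr is_true.
  rewrite -ltr_norml -[RHS]ltr_sqr ?nnegrE ?(ltW a0)// real_normK ?num_real//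
    a2.
  by rewrite ltrBrDr.
rewrite [X in (X <= _)%E](_ : _ = (\int[lebesgue_measure]_(t in `](- a)%R, a[)
    (f (upd x i (t + eta)) + f (upd x i (t - eta)) - 2 *
      f (upd x i t))%R%:E)%E); last first.
  rewrite [RHS]integral_mkcond; apply: eq_integral => t _; rewrite !patchE.
  rewrite (_ : (upd x i t \in eball R) = (t \in `]-a, a[%classic)).
    by rewrite /sdiff updD -scaleNr updD.
  by apply/idP/idP; rewrite !inE inB /= in_itv.
apply: (@le_trans _ _ (2 * (L * eta) * eta)%:E).
  apply: (@integral_second_difference K (fun t => f (upd x i t))) => //.
  - by apply: (measurableT_comp mf); exact: measurable_upd.
  - by rewrite mulr_ge0.
  - move=> s /andP[s1 s2].
    (* u ^ 2 + r2 < (a + eta) ^ 2 + r2 <= 4 R ^ 2, as a ^ 2 + r2 = R ^ 2. *)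
    have in2B u : - (a + eta) < u < a + eta -> eball (2 * R) (upd x i u).
      move=> ua; rewrite /eball/= enorm_ltE ?mulr_gt0// dotv_upd -/r2.
      have : `|u| ^+ 2 < (a + eta) ^+ 2 by rewrite ltr_sqr ?nnegrE ?addr_ge0
        ?(ltW a0)// ltr_norml.
      rewrite real_normK ?num_real// => h.
      have h1 : a * eta <= R ^+ 2 by rewrite expr2 ler_pM// ltW.
      have h2 : eta ^+ 2 <= R ^+ 2 by rewrite ler_sqr ?nnegrE// ltW.
      rewrite exprMn; rewrite sqrrD in h; lra.
    apply: (le_trans (fL _ _ _ _)); [apply: in2B; lra|apply: in2B; lra|].
    rewrite -updD [upd _ _ _ + _]addrC addrK enormZ enorm_evec mulr1
      ger0_norm//.
  - move=> s sa; have := D0 (upd x i s).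
    by rewrite inB => /(_ sa); rewrite /sdiff updD -scaleNr updD.
rewrite lee_fin -mulrA [L * eta]mulrC !mulrA -[X in X <=
  _]mulr1 -[in leRHS](mulrA _ (expR _)).
rewrite [2 * eta * L]mulrAC -(mulrA _ eta eta) -expr2.
rewrite ler_wpM2l ?mulr_ge0 ?sqr_ge0//.
by apply: gauss_weight_large => //; exact: ltW.
Qed.

End second_difference.

(** * Convexity along a line and differentiability *)

(** Jensen's inequality for the uniform mean.  Working with finite upper
    bounds b j rather than with the values f (y j) avoids sums of infinite
    values. *)
Lemma convex_efun_mean (K : realType) d (f : 'rV[K]_d -> \bar K) k
    (y : nat -> 'rV[K]_d) (b : nat -> K) :
  convex_efun f -> (forall j, (j < k.+1)%N -> (f (y j) <= (b j)%:E)%E) ->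
  (f (k.+1%:R^-1 *: \sum_(j < k.+1) y j) <=
     (k.+1%:R^-1 * \sum_(j < k.+1) b j)%:E)%E.
Proof.
move=> cf; elim: k => [|k IHk] fb.
  by rewrite !big_ord_recl !big_ord0 !addr0 invr1 scale1r mul1r fb.
have k1 : 0 < k.+1%:R :> K by [].
have k2 : 0 < k.+2%:R :> K by [].
pose t : K := k.+1%:R / k.+2%:R.
have t0 : 0 <= t by rewrite divr_ge0.
have t1 : 1 - t = k.+2%:R^-1.
  rewrite /t -[X in X - _](@divff _ k.+2%:R) ?pnatr_eq0// -mulrBl -natrB//.
  by rewrite subSnn mul1r.
have tk : t * k.+1%:R^-1 = k.+2%:R^-1 by rewrite /t mulrAC divff ?mul1r//
  pnatr_eq0.
have t01 : 0 <= t <= 1 by rewrite t0 -subr_ge0 t1 invr_ge0 ltW.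
rewrite [in leRHS]big_ord_recr/= big_ord_recr/=.
set S := \sum_(i < k.+1) y i; set B := \sum_(i < k.+1) b i.
have -> : k.+2%:R^-1 *: (S + y k.+1) = t *: (k.+1%:R^-1 *: S) +
  (1 - t) *: y k.+1.
  by rewrite t1 scalerA tk scalerDr.
have -> : k.+2%:R^-1 * (B + b k.+1) = t * (k.+1%:R^-1 * B) + (1 - t) * b k.+1.
  by rewrite t1 mulrA tk mulrDr.
apply: (le_trans (cf _ _ t t01)); rewrite [leRHS]EFinD; apply: leeD;
  rewrite [leRHS]EFinM.
  by apply: lee_wpmul2l; rewrite ?lee_fin//; apply: IHk => j jk; apply: fb;
    exact: leqW.
by apply: lee_wpmul2l; [rewrite lee_fin t1 invr_ge0 ltW|exact: fb].
Qed.

Section line.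
Context (K : realType) (g : K -> K) (delta : K).
Hypothesis delta0 : 0 < delta.
Hypothesis cg : forall a b t, `|a| <= delta -> `|b| <= delta -> 0 <= t <= 1 ->
  g (t * a + (1 - t) * b) <= t * g a + (1 - t) * g b.

Let D t := g t + g (- t) - 2 * g 0.

(** The quotient D t / t of a convex function is nondecreasing; it is written
    without denominators. *)
Lemma line_sdiff_mono s t : 0 < t -> t <= s -> s <= delta -> s * D t <= t * D s.
Proof.
move=> t0 ts sd; have s0 := lt_le_trans t0 ts.
have r01 : 0 <= t / s <= 1 by rewrite divr_ge0 ?(ltW t0) ?(ltW s0)//=
  ler_pdivrMr// mul1r.
have sn : `|s| <= delta by rewrite gtr0_norm.
have sn' : `|- s| <= delta by rewrite normrN.
have z0 : `|0 : K| <= delta by rewrite normr0 ltW.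
have h1 := cg sn z0 r01; have h2 := cg sn' z0 r01.
move: h1 h2; rewrite !mulr0 !addr0 mulrN divfK ?gt_eqF// => h1 h2.
have s1 : s * (t / s) = t by rewrite mulrC divfK ?gt_eqF.
have := ler_wpM2l (ltW s0) (lerD h1 h2); rewrite /D.
rewrite [X in _ <= X -> _](_ : _ = (s * (t / s)) * (g s + g (- s)) + 2 *
  (s - s * (t / s)) * g 0); last by ring.
by rewrite s1; lra.
Qed.

(** A convex function on the line has a subgradient at 0: the supremum a of
    the left slopes is below all right slopes.  The two nonnegative remainders at t
    and at - t add up to the second difference, so each is bounded by it. *)
Lemma line_slope : exists a : K, forall t, `|t| <= delta ->
  0 <= g t - g 0 - a * t <= D `|t|.
Proof.
have slope s t : 0 < s <= delta -> 0 < t <= delta ->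
    (g 0 - g (- t)) / t <= (g s - g 0) / s.
  move=> /andP[s0 sd] /andP[t0 td]; rewrite ler_pdivrMr// mulrAC ler_pdivlMr//.
  have st0 : 0 < s + t by rewrite addr_gt0.
  have r01 : 0 <= s / (s + t) <= 1.
    by rewrite divr_ge0 ?(ltW st0) ?(ltW s0)//= ler_pdivrMr//
      mul1r lerDl (ltW t0).
  have sn : `|s| <= delta by rewrite gtr0_norm.
  have tn : `|- t| <= delta by rewrite normrN gtr0_norm.
  have := cg tn sn r01.
  rewrite [X in g X](_ : _ = 0); last by field; rewrite gt_eqF.
  move=> /(ler_wpM2l (ltW st0)).
  rewrite [X in _ <= X -> _](_ : _ = s * g (- t) + t * g s); last by field;
    rewrite gt_eqF.
  lra.
have dd : 0 < delta <= delta by rewrite delta0 lexx.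
pose S := [set (g 0 - g (- t)) / t | t in [set t | 0 < t <= delta]].
have S0 : S !=set0 by exists ((g 0 - g (- delta)) / delta); exists delta.
have ubS s : 0 < s <= delta -> ubound S ((g s - g 0) / s).
  by move=> sd _ [t td <-]; exact: slope.
have hS : has_sup S by split=> //; exists ((g delta - g 0) / delta); exact: ubS.
exists (sup S).
have up t : 0 < t <= delta -> sup S * t <= g t - g 0.
  move=> /[dup] td /andP[t0 _]; rewrite -ler_pdivlMr//.
  by apply: ge_sup => //; exact: ubS.
have lo t : 0 < t <= delta -> g 0 - g (- t) <= sup S * t.
  move=> /[dup] td /andP[t0 _]; rewrite -ler_pdivrMr//.
  by apply: ub_le_sup; [case: hS|exists t].
move=> t td; have [t0|t0|->] := ltgtP t 0.
- rewrite ltr0_norm// /D opprK.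
  have tt : 0 < - t <= delta by rewrite oppr_gt0 t0 -[- t]ltr0_norm.
  by have := lo _ tt; have := up _ tt; rewrite opprK; lra.
- have tt : 0 < t <= delta by rewrite t0 -[t]gtr0_norm.
  rewrite gtr0_norm// /D.
  by have := lo _ tt; have := up _ tt; lra.
- by rewrite normr0 /D oppr0; lra.
Qed.

End line.

Section dot_linear.
Context (K : realType) (d : nat) (a : 'rV[K]_d).
Definition dotr (v : 'rV[K]_d) : K := dotv v a.
Lemma dotr_linear : linear dotr.
Proof. by move=> c x y; rewrite /dotr dotvDl dotvZl. Qed.
HB.instance Definition _ := GRing.isLinear.Build K 'rV[K]_d K *:%R dotr
  dotr_linear.

Lemma continuous_dotr : continuous dotr.
Proof.
rewrite /dotr /dotv; apply: continuous_big => // [|i _];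
  first exact: add_continuous.
move=> x; apply: (@cvgM _ _ _ (nbhs_filter x)); first exact: coord_continuous.
exact: cvg_cst.
Qed.
End dot_linear.

(** The gradient read off from a first order expansion; the error is measured
    in the sup norm, which is the norm of the topology of row vectors. *)
Lemma differentiable_of_expansion (K : realType) d (u : 'rV[K]_d ->
  K) (x a : 'rV[K]_d) :
  (forall e, 0 < e -> \forall v \near (0 : 'rV[K]_d),
     `|u (v + x) - u x - dotv v a| <= e * `|v|) ->
  differentiable u x /\ (forall i, 'D_(evec K i) u x = a ord0 i).
Proof.
move=> H.
have E : u \o shift x = cst (u x) + (dotr a : {linear 'rV[K]_d ->
  K}) +o_ (0 : 'rV[K]_d) id.
  apply/eqaddoP => e e0; apply: filterS (H _ e0) => v.
  by rewrite /= opprD addrA.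
have dE := @diff_unique K _ _ u (dotr a : {linear 'rV[K]_d ->
  K}) x (@continuous_dotr _ _ a) E.
have du : differentiable u x.
  apply/diff_locallyP; rewrite dE; split => //; exact: continuous_dotr.
split=> // i; rewrite deriveE// dE.
by rewrite /= /dotr dotv_evec.
Qed.

(** * Gradients of Lipschitz functions *)

Section gradient.
Context (K : realType) (d : nat) (f : 'rV[K]_d -> \bar K) (R L : K).
Hypotheses (R0 : 0 < R) (L0 : 0 <= L).
Hypothesis fL : lipschitz_on_eball f (2 * R) L.

Let u := fine \o f.

Lemma eball_sub (x : 'rV[K]_d) : eball R x -> eball (2 * R) x.
Proof. by rewrite /eball/= => xR; rewrite (lt_trans xR)// ltr_pMl// ltr1n. Qed.

Lemma finite_near (x : 'rV[K]_d) : eball (2 * R) x ->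
  \forall y \near x, eball (2 * R) y.
Proof. by move=> xB; apply: open_nbhs_nbhs; split => //; exact: open_eball. Qed.

(** If a is the gradient then the derivative in the direction a is |a|^2, and
    it is at most L |a|. *)
Lemma enorm_grad_le (x : 'rV[K]_d) : eball (2 * R) x -> enorm (grad f x) <= L.
Proof.
move=> xB; rewrite /grad; case: asboolP => [[_ du]|_]; last first.
  by rewrite /enorm /dotv big1 ?sqrtr0// => i _; rewrite mxE mul0r.
set a := \row_i _.
have aE : 'D_a u x = dotv a a.
  rewrite deriveE// {1}[a]row_sum_delta linear_sum; apply: eq_bigr => i _.
  by rewrite linearZ -deriveE//= mxE.
have dleL : 'D_a u x <= L * enorm a.
  apply: limr_le; first exact: diff_derivable.
  have ca : (fun h : K => h *: a + x) @ (0 : K) --> x.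
    have z : 0 *: a + x = x by rewrite scale0r add0r.
    rewrite -[X in _ --> X]z; apply: cvgD; last exact: cvg_cst.
    exact: scalel_continuous.
  have /nbhs_dnbhs nB := ca _ (finite_near xB).
  near=> h; have h0 : h != 0 by near: h; exact: nbhs_dnbhs_neq.
  have hB : eball (2 * R) (h *: a + x) by near: h.
  have := (fL.2 _ _ hB xB); rewrite addrK enormZ => /le_trans ub.
  apply: (le_trans (ler_norm _)); rewrite normrZ normfV.
  rewrite ler_pdivrMl ?normr_gt0// mulrCA; exact: ub.
have [a0|a0] := eqVneq (enorm a) 0; first by rewrite a0.
rewrite -(@ler_pM2r _ (enorm a)); last by rewrite lt0r a0 enorm_ge0.
by rewrite -expr2 sqr_enorm -aE.
Unshelve. all: by end_near. Qed.

End gradient.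

(** * Differentiability of convex functions with flat second differences *)

Section convex_gradient.
Context (K : realType) (k : nat).
Let d := k.+1.
Variables (f : 'rV[K]_d -> \bar K) (R L : K).
Hypotheses (R0 : 0 < R) (pf : proper_fun f) (cf : convex_efun f).
Hypothesis fL : lipschitz_on_eball f (2 * R) L.

Let u := fine \o f.

Let fin x i (t : K) : eball R x -> `|t| <= R -> f (x + t *: evec K i) = (u (x +
  t *: evec K i))%:E.
Proof.
by move=> xB tR; rewrite /u/= fineK//; apply: fL.1; exact: eball_shift.
Qed.

Let line x i (a b t : K) : eball R x -> `|a| <= R -> `|b| <= R -> 0 <= t <= 1 ->
  u (x + (t * a + (1 - t) * b) *: evec K i) <=
    t * u (x + a *: evec K i) + (1 - t) * u (x + b *: evec K i).
Proof.
move=> xB aR bR /[dup] t01 /andP[t0 t1].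
have tR : `|t * a + (1 - t) * b| <= R.
  rewrite (le_trans (ler_normD _ _))// !normrM (ger0_norm t0) (@ger0_norm _ (1
    - t)) ?subr_ge0//.
  have t1' : 0 <= 1 - t by rewrite subr_ge0.
  by have := ler_wpM2l t0 aR; have := ler_wpM2l t1' bR; lra.
have := cf (x + a *: evec K i) (x + b *: evec K i) t01.
rewrite !scalerDr !scalerA addrACA -!scalerDl subrKC scale1r.
by rewrite !fin// -!EFinM -EFinD lee_fin.
Qed.

Lemma convex_slope x i : eball R x -> exists a : K, forall t, `|t| <= R ->
  0 <= u (x + t *: evec K i) - u x - a * t <= sdiff u i `|t| x.
Proof.
move=> xB; have [|a Ha] := @line_slope _ (fun t => u (x + t *: evec K i)) R R0.
  by move=> a b t aR bR t01; exact: line.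
by exists a => t tR; have := Ha t tR; rewrite /sdiff scale0r addr0 scaleNr.
Qed.

Lemma sdiff_ge0 x i (eta : K) : eball R x -> 0 <= eta <= R -> 0 <=
  sdiff u i eta x.
Proof.
move=> xB /andP[e0 eR]; have [a] := convex_slope i xB.
move=> /(_ eta); rewrite ger0_norm// => /(_ eR) /andP[]; exact: le_trans.
Qed.

Lemma sdiff_mono x i (s t : K) : eball R x -> 0 < t -> t <= s -> s <= R ->
  s * sdiff u i t x <= t * sdiff u i s x.
Proof.
move=> xB t0 ts sR; have := @line_sdiff_mono _ (fun t => u (x +
  t *: evec K i)) R R0.
move=> /(_ _ _ _ t0 ts sR); rewrite /sdiff scale0r addr0 !scaleNr; apply.
by move=> a b r aR bR r01; exact: line.
Qed.

(** Let a_i be a slope in the direction e_i, from [convex_slope].  Flatness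
    makes the remainder u (x + t e_i) - u x - a_i t small with respect to t in each
    coordinate direction.  Since x + v is the mean of the points x + d v_i e_i,
    Jensen's inequality bounds the remainder at v from above, and convexity between
    x + v and x - v turns the upper bound at - v into a lower bound at v.  Hence u is
    differentiable at x with gradient a. *)
Lemma grad_convex_slope x : eball R x ->
  (forall i e, 0 < e -> exists2 t, 0 < t <= R & sdiff u i t x <= e * t) ->
  forall i t, `|t| <= R ->
    0 <= u (x + t *: evec K i) - u x - grad f x ord0 i * t <= sdiff u i `|t| x.
Proof.
move=> xB flat.
have /fin_all_exists[a Ha] i := convex_slope i xB.
suff -> : grad f x = \row_i a i by move=> i t tR; rewrite mxE; exact: Ha.
set av := \row_i a i.
have [du dE] : differentiable u x /\ (forall i, 'D_(evec K i) u x = av ord0 i).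
  apply: differentiable_of_expansion => e' e'0.
  (* The points x + d v_i e_i lie at distance d |v_i| from x, hence the factor d. *)
  pose e := e' / d%:R; have e0 : 0 < e by rewrite divr_gt0.
  have /fin_all_exists2[t t0R te] i := flat i _ e0.
  have [del del0 delt] : exists2 del : K, 0 < del & forall i, del <= t i.
    exists (\big[Num.min/R]_i t i).
      by elim/big_ind : _ => // [p q p0 q0|i _];
        [rewrite lt_min p0|case/andP: (t0R i)].
    by move=> i; rewrite (bigD1 i)//= ge_min lexx.
  have small i (s : K) : `|s| <= del -> sdiff u i `|s| x <= e * `|s|.
    move=> sdel; have [->|s0] := eqVneq s 0.
      by rewrite normr0 mulr0 /sdiff scale0r subr0 addr0; lra.
    have /andP[ti0 tiR] := t0R i.
    have sp : 0 < `|s| by rewrite normr_gt0.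
    have := sdiff_mono i xB sp (le_trans sdel (delt i)) tiR.
    move=> /le_trans /(_ (ler_wpM2l (ltW sp) (te i))).
    by rewrite mulrCA [t i * _]mulrC mulrA ler_pM2r// mulrC.
  have upper (v : 'rV[K]_d) : d%:R * `|v| <= del -> d%:R * `|v| <= R ->
      (f (v + x) <= (u x + dotv v av + e * (d%:R * `|v|))%:E)%E.
    move=> vdel vR.
    pose y j : 'rV[K]_d := x + (d%:R * v ord0 (inord j)) *: evec K (inord j).
    pose b j : K := u x + a (inord j) * (d%:R * v ord0 (inord j)) + e * (d%:R *
      `|v|).
    have vj i : `|d%:R * v ord0 i| <= d%:R * `|v|.
      rewrite normrM ger0_norm// ler_wpM2l//; rewrite [leRHS]mx_normrE.
      exact: (le_bigmax _ (fun ij => `|v ij.1 ij.2|) (ord0, i)).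
    have fb j : (j < k.+1)%N -> (f (y j) <= (b j)%:E)%E.
      move=> _; rewrite /y fin//; last exact: le_trans (vj _) vR.
      rewrite lee_fin /b.
      have := Ha (inord j) (d%:R * v ord0 (inord j)) (le_trans (vj _) vR).
      have := small (inord j) _ (le_trans (vj (inord j)) vdel).
      have := ler_wpM2l (ltW e0) (vj (inord j)).
      lra.
    have := convex_efun_mean cf fb.
    have d0 : d%:R != 0 :> K by rewrite pnatr_eq0.
    rewrite [X in (f X <= _)%E](_ : _ = v + x); last first.
      rewrite big_split/= sumr_const card_ord -[x *+ _]scaler_nat scalerDr
        scalerA mulVf// scale1r addrC.
      rewrite [in RHS](row_sum_delta v) scaler_sumr; congr (_ + _);
        apply: eq_bigr => j _.
      by rewrite inord_val scalerA mulKf.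
    rewrite [X in (_ <= X%:E)%E -> _](_ : _ = u x + dotv v av + e * (d%:R *
      `|v|))//.
    rewrite !big_split/= !sumr_const card_ord -[u x *+ _]mulr_natl -[(e *
      _) *+ _]mulr_natl !mulrDr !(mulKf d0).
    congr (_ + _ + _); rewrite mulr_sumr /dotv; apply: eq_bigr => j _.
    by rewrite inord_val mxE mulrCA mulKf// mulrC.
  have near_small (r : K) : 0 < r -> \forall v \near (0 : 'rV[K]_d), d%:R *
    `|v| <= r.
    move=> r0; have dr : 0 < r / d%:R by rewrite divr_gt0.
    by apply: filterS (nbhs0_le dr) => v; rewrite ler_pdivlMr// mulrC.
  near=> v.
  have vdel : d%:R * `|v| <= del by near: v; exact: near_small.
  have vR : d%:R * `|v| <= R by near: v; exact: near_small.
  have up1 := upper v vdel vR.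
  have := upper (- v); rewrite normrN => /(_ vdel vR) up2.
  have isfin w (c : K) : (f w <= c%:E)%E -> f w = (u w)%:E.
    by have := pf.1 w; rewrite /u/=; case: (f w).
  have h01 : 0 <= (2^-1 : K) <= 1 by lra.
  have := cf (v + x) (- v + x) h01.
  rewrite (_ : _ *: _ + _ = x); last first.
    rewrite (_ : 1 - 2^-1 = 2^-1 :> K); last by field.
    rewrite -scalerDr addrACA subrr add0r -[x +
      x]mulr2n -[x *+ 2]scaler_nat scalerA.
    by rewrite mulVf ?scale1r// pnatr_eq0.
  have fx : f x = (u x)%:E by rewrite /u/= fineK//; apply: fL.1;
    exact: eball_sub.
  have f1 := isfin _ _ up1; have f2 := isfin _ _ up2.
  move: up1 up2; rewrite fx f1 f2 -!EFinM -EFinD !lee_fin.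
  rewrite -scaleN1r dotvZl => up1 up2 mid.
  have ed : e * (d%:R * `|v|) = e' * `|v| by rewrite mulrA divfK// pnatr_eq0.
  by rewrite ler_norml; move: up1 up2; rewrite ed; lra.
rewrite /grad asboolT; last first.
  split => //; apply: filterS (finite_near (eball_sub R0 xB)) => y yB;
    exact: fL.1.
by apply/rowP => i; rewrite mxE -dE.
Unshelve. all: by end_near. Qed.

End convex_gradient.

(** * Lower integrals and the Fenchel gap *)

Section nonmeasurable.
Context d (T : measurableType d) (K : realType).
Variable mu : {measure set T -> \bar K}.
Local Open Scope ereal_scope.
Import HBNNSimple.

Lemma nonneg_integral_mono (g1 g2 : T -> \bar K) :
  (forall x, 0 <= g1 x) -> (forall x, g1 x <= g2 x) ->
  \int[mu]_x g1 x <= \int[mu]_x g2 x.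
Proof.
move=> g10 g12; have g20 x : 0 <= g2 x by exact: le_trans (g12 x).
rewrite !ge0_integralTE//; apply: ge_ereal_sup => _ [h /= hg <-].
apply: ereal_sup_ubound; exists h => //= x; exact: le_trans (hg x) (g12 x).
Qed.

(** The functions h and g are arbitrary: their integrals are suprema over
    simple functions below them.  If s is simple and s <= h, then (s - D)^+ / c,
    set to 0 on the exceptional null set, is measurable and below g, while s is
    almost everywhere at most c times it plus D.  It is
    applied to expressions in gradients and conjugates. *)
Lemma nonneg_integral_le_affine (h g : T -> \bar K) (D : T -> K) (c : K) :
  (0 < c)%R -> (forall x, 0 <= h x) -> (forall x, 0 <= g x) ->
  (forall x, 0 <= D x)%R -> measurable_fun setT D ->
  {ae mu, forall x, h x <= c%:E * g x + (D x)%:E} ->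
  \int[mu]_x h x <= c%:E * \int[mu]_x g x + \int[mu]_x (D x)%:E.
Proof.
move=> c0 h0 g0 D0 mD [N [mN N0 hN]].
rewrite [leLHS]ge0_integralTE//; apply: ge_ereal_sup => _ [s /= sh <-].
have -> : sintegral mu s = \int[mu]_x (s x)%:E by rewrite integral_nnsfun//
  patch_setT.
have ms : measurable_fun setT s by [].
pose k x : K := (\1_(~` N) x * (Num.max (s x - D x) 0 / c))%R.
have k0 x : (0 <= k x)%R.
  by rewrite mulr_ge0// ?divr_ge0 ?(ltW c0)// le_max lexx orbT.
have mk : measurable_fun setT k.
  apply: measurable_funM; first by apply: measurable_indic; exact: measurableC.
  apply: measurable_funM => //; apply: measurable_maxr => //.
  exact: measurable_funB.
have kg x : (k x)%:E <= g x.
  rewrite /k indicE; case: (boolP (x \in ~` N)) => xN; last by rewrite mul0r.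
  rewrite mul1r; have : h x <= c%:E * g x + (D x)%:E.
    by apply: contrapT => nh; move: xN; rewrite inE => /(_ (hN _ nh)).
  move=> /(le_trans (sh x)); have := g0 x; case: (g x) => [r| |]//=;
    last by move=> *; rewrite leey.
  rewrite !lee_fin => r0 le1.
  rewrite ler_pdivrMr// ge_max; apply/andP; split; first by lra.
  by rewrite mulr_ge0// ltW.
apply: (@le_trans _ _ (\int[mu]_x (c%:E * (k x)%:E + (D x)%:E))).
  apply: ae_ge0_le_integral => //.
  - by move=> x _; rewrite lee_fin.
  - exact/measurable_EFinP.
  - by move=> x _; rewrite -EFinM -EFinD lee_fin addr_ge0// mulr_ge0// ltW.
  - apply: emeasurable_funD; last exact/measurable_EFinP.
    by apply: measurable_funeM; exact/measurable_EFinP.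
  - exists N; split => // x /= /not_implyP[_ nle]; apply: contrapT => xN;
    apply: nle.
    rewrite -EFinM -EFinD lee_fin /k indicE mem_set//
      mul1r mulrC divfK ?gt_eqF//.
    by rewrite -lerBlDr le_max lexx.
rewrite ge0_integralD//=; last 4 first.
- by move=> x _; rewrite -EFinM lee_fin mulr_ge0// ltW.
- by apply: measurable_funeM; exact/measurable_EFinP.
- by move=> x _; rewrite lee_fin.
- exact/measurable_EFinP.
rewrite ge0_integralZl//=; last 3 first.
- exact/measurable_EFinP.
- by move=> x _; rewrite lee_fin.
- by rewrite lee_fin ltW.
apply: leeD => //; apply: lee_wpmul2l; first by rewrite lee_fin ltW.
by apply: nonneg_integral_mono => // x; rewrite lee_fin.
Qed.

End nonmeasurable.

Section fenchel.
Context (K : realType) (d : nat) (f : 'rV[K]_d -> \bar K).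
Hypothesis pf : proper_fun f.

Lemma conjugate_ge (y p : 'rV[K]_d) : ((dotv y p)%:E - f y <= conjugate f p)%E.
Proof. by apply: ereal_sup_ubound; exists y. Qed.

Lemma fenchel_gap_ge0 (x p : 'rV[K]_d) :
  (0 <= f x + conjugate f p - (dotv x p)%:E)%E.
Proof.
have [ninf [x0 x0y]] := pf.
have := conjugate_ge x p; have := conjugate_ge x0 p.
have := ninf x; have := ninf x0; move: x0y; case: (f x0) => // r0 _ _.
case: (f x) => [r| |]//= _.
  case: (conjugate f p) => [c| |]//=; rewrite -?EFinB -?EFinD ?lee_fin ?leey//.
  by move=> _; lra.
by case: (conjugate f p) => [c| |]//= *; rewrite ?leey.
Qed.

Lemma fenchel_gap_ge (x y p : 'rV[K]_d) (a b : K) : f x = a%:E -> f y = b%:E ->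
  ((dotv (y - x) p - (b - a))%:E <= f x + conjugate f p - (dotv x p)%:E)%E.
Proof.
move=> fx fy; have := conjugate_ge y p; rewrite fx fy.
case: (conjugate f p) => [c| |]//=; rewrite -?EFinB -?EFinD ?lee_fin ?leey//.
by rewrite dotvBl; lra.
Qed.

End fenchel.

(** Take y = x + t e_i with t = eta or t = - eta in the definition of the
    conjugate: g >= t (p_i - a_i) - (u y - u x - a_i t), and the last term is at most
    the second difference.  The sign of t is that of p_i - a_i. *)
Lemma coord_diff_le (K : realType) d (f : 'rV[K]_d ->
  \bar K) (x p a : 'rV[K]_d) i
    (eta : K) : 0 <= eta ->
  (forall t, `|t| <= eta -> f (x + t *: evec K i) \is a fin_num) ->
  (forall t, `|t| <= eta -> 0 <= (fine \o f) (x + t *: evec K i) -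
     (fine \o f) x - a ord0 i * t <= sdiff (fine \o f) i `|t| x) ->
  ((eta * `|p ord0 i - a ord0 i|)%:E <=
    f x + conjugate f p - (dotv x p)%:E + (sdiff (fine \o f) i eta x)%:E)%E.
Proof.
move=> eta0 fin sl.
have fx : f x = ((fine \o f) x)%:E.
  by have := fin 0; rewrite scale0r addr0 normr0 => /(_ eta0)/fineK <-.
have key t : `|t| = eta ->
    ((t * (p ord0 i - a ord0 i))%:E <=
    f x + conjugate f p - (dotv x p)%:E + (sdiff (fine \o f) i eta x)%:E)%E.
  move=> te; have te' : `|t| <= eta by rewrite te.
  have := @fenchel_gap_ge _ _ f x (x + t *: evec K i) p _ _ fx (esym (fineK
    (fin _ te'))).
  move=> h; rewrite -leeBlDr// -EFinB; apply: le_trans h; rewrite lee_fin.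
  rewrite [x + _]addrC addrK dotvZl dotv_evec.
  by have := sl _ te'; rewrite te /= [x + _]addrC; lra.
have [s0|s0] := leP 0 (p ord0 i - a ord0 i).
  by rewrite ger0_norm//; apply: key; rewrite ger0_norm.
by rewrite ltr0_norm// mulrN -mulNr; apply: key; rewrite normrN ger0_norm.
Qed.

(** * The estimate at a fixed scale *)

Section gradient_stability.
Context (K : realType) (k : nat).
Let d := k.+1.
Variables (R L M q : K) (mu : probability 'rV[K]_d K) (phibar phi : 'rV[K]_d ->
  \bar K).
Hypotheses (R0 : 0 < R) (L0 : 0 < L) (M0 : 0 < M).
Hypothesis muM : has_density_le mu M.
Hypothesis muR : mu (~` eball R) = 0%E.
Hypotheses (Cphi : convex_lsc phi).
Hypotheses (Lbar : lipschitz_on_eball phibar (2 * R) L)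
  (Lphi : lipschitz_on_eball phi (2 * R) L).

Let u := fine \o phi.
Let A := slice_const d R.
Let A0 : 0 <= A. Proof. exact: slice_const_ge0. Qed.
Let pphi : proper_fun phi. Proof. by case: Cphi. Qed.
Let cphi : convex_efun phi. Proof. by case: Cphi. Qed.

Let measurable_u : measurable_fun setT u.
Proof.
case: Cphi => _ _ /lower_semicontinuousP lsc.
apply: measurableT_comp; first exact: fine_measurable.
apply: (measurability _ (ErealGenOInfty.measurableE K)).
move=> /= _ [_ [a ->]] <-; apply: measurableI => //; apply: sub_sigma_algebra.
by rewrite preimage_itvoy; exact: lsc.
Qed.

Let sdiff0 i (eta : K) x : 0 <= eta <= R -> eball R x -> 0 <= sdiff u i eta x.
Proof. by move=> etaR xB; exact: (sdiff_ge0 R0 cphi Lphi). Qed.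

Let ball_ae : {ae mu, forall x, eball R x}.
Proof.
exists (~` eball R); split => //; apply: measurableC; exact: measurable_eball.
Qed.

Let msd i eta : measurable_fun setT (EFin \o sdiff u i eta).
Proof. by apply/measurable_EFinP; exact: measurable_sdiff. Qed.

Lemma sdiff_integral_mu_le i (eta : K) : 0 <= eta <= R ->
  (\int[mu]_(x in eball R) (sdiff u i eta x)%:E <=
     (M * (2 * L * eta ^+ 2 * A))%:E)%E.
Proof.
move=> etaR; apply: (le_trans (has_density_integral_le (ltW M0) muM _ _ _)).
- exact: measurable_eball.
- exact: measurable_funTS (msd i eta).
- by move=> x xB; rewrite lee_fin; exact: sdiff0.
rewrite EFinM; apply: lee_wpmul2l; first by rewrite lee_fin ltW.
apply: sdiff_integral_le => //; first exact: ltW.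
  exact: Lphi.2.
by move=> x xB; exact: sdiff0.
Qed.

(** Let Z be R times the infimum of the quotients sdiff u i t x / t over the
    t = R / (n + 1).  Its integral over the ball is O(1 / n) for all n, so Z
    vanishes almost everywhere. *)
Lemma sdiff_flat_ae i : {ae mu, forall x, eball R x ->
  forall e, 0 < e -> exists2 t, 0 < t <= R & sdiff u i t x <= e * t}.
Proof.
have mB := @measurable_eball K d R.
pose tn n : K := R / n.+1%:R.
have tn0 n : 0 < tn n by rewrite divr_gt0.
have tnR n : 0 <= tn n <= R.
  by rewrite ltW//= ler_pdivrMr// ler_peMr ?(ltW R0)// ler1n.
pose s n x : \bar K := (n.+1%:R * sdiff u i (tn n) x)%:E.
have ms n : measurable_fun setT (s n).
  by apply/measurable_EFinP; apply: measurable_funM => //;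
    exact: measurable_sdiff.
have s0 n x : eball R x -> (0 <= s n x)%E.
  by move=> xB; rewrite lee_fin mulr_ge0//; exact: sdiff0.
pose Z x := einfs (s ^~ x) 0%N.
have mZ : measurable_fun (eball R) Z.
  by apply: measurable_fun_einfs => n; exact: measurable_funTS.
have Z0 x : eball R x -> (0 <= Z x)%E.
  move=> xB; rewrite /Z /einfs/=; apply: le_ereal_inf_tmp => _ [n _ <-];
    exact: s0.
have Zs n x : (Z x <= s n x)%E.
  by rewrite /Z /einfs/=; apply: ereal_inf_lbound; exists n.
have intZ n : (\int[mu]_(x in eball R) `|Z x| <= (n.+1%:R^-1 * (M * (2 * L *
  R ^+ 2 * A)))%:E)%E.
  apply: (@le_trans _ _ (\int[mu]_(x in eball R) (n.+1%:R%:E *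
    (sdiff u i (tn n) x)%:E))%E).
    apply: ge0_le_integral => //.
    - exact: measurableT_comp.
    - by apply: measurable_funeM; exact: measurable_funTS (msd i (tn n)).
    - by move=> x xB; rewrite gee0_abs ?Z0// -EFinM; exact: Zs.
  rewrite ge0_integralZl//.
  - apply: (le_trans (lee_wpmul2l _ (sdiff_integral_mu_le i (tnR n))));
    first by rewrite lee_fin.
    rewrite -EFinM lee_fin le_eqVlt; apply/orP; left; apply/eqP; rewrite /tn.
    have : n.+1%:R != 0 :> K by rewrite pnatr_eq0.
    by move: (n.+1%:R : K) => m m0; field.
  - exact: measurable_funTS (msd i (tn n)).
  - by move=> x xB; rewrite lee_fin; exact: sdiff0.
have intZ0 : (\int[mu]_(x in eball R) `|Z x| = 0)%E.
  apply/eqP; rewrite eq_le integral_ge0 ?andbT//; apply/lee_addgt0Pr => e e0;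
    rewrite add0e.
  set c := M * (2 * L * R ^+ 2 * A) in intZ.
  have c0 : 0 <= c.
    apply: mulr_ge0; first exact: ltW.
    by apply: mulr_ge0 => //; rewrite mulr_ge0 ?sqr_ge0// mulr_ge0// ltW.
  have [n _ /(_ n (leqnn n)) ne] := near_infty_natSinv_lt (PosNum (divr_gt0 e0
    (ltr_wpDl c0 ltr01))).
  apply: le_trans (intZ n) _; rewrite lee_fin.
  move: ne => /=; rewrite ltr_pdivlMr ?ltr_wpDl// mulrDr => ne.
  by rewrite (le_trans _ (ltW ne))// lerDl mulr1.
have /(ae_eq_integral_abs mu mB mZ) := intZ0.
apply: filterS => x Zx xB e e0; have := Zx xB => /= Zx0.
have : (Z x < (e * R)%:E)%E by rewrite Zx0 lte_fin mulr_gt0.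
rewrite /Z /einfs/= => /ereal_inf_lt[_ [n _ <-]].
rewrite lte_fin => /ltW sn; exists (tn n); first by rewrite tn0;
  case/andP: (tnR n).
by rewrite /tn mulrA ler_pdivlMr// mulrC.
Qed.

Lemma slope_ae : {ae mu, forall x, eball R x -> forall i t, `|t| <= R ->
    0 <= u (x + t *: evec K i) - u x - grad phi x ord0 i * t <=
      sdiff u i `|t| x}.
Proof.
have := filter_forall (ae_filter_ringOfSetsType mu) (fun i => sdiff_flat_ae i).
apply: filterS => x flat xB.
apply: (grad_convex_slope R0 pphi cphi Lphi xB) => i e e0.
exact: flat.
Qed.

Hypothesis q12 : 1 <= q <= 2.

Let z x : K := enorm (grad phibar x - grad phi x).

Let q0 : 0 < q. Proof. by case/andP: q12 => /(lt_le_trans ltr01). Qed.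

Lemma enorm_grad_diff_le x : eball R x -> z x <= 2 * L.
Proof.
move=> xB; have xB2 := eball_sub R0 xB.
apply: enormB_le; first exact: (enorm_grad_le (ltW L0) Lbar xB2).
exact: (enorm_grad_le (ltW L0) Lphi xB2).
Qed.

Lemma powR_le_linear x : eball R x -> z x `^ q <= (2 * L) `^ (q - 1) * z x.
Proof.
move=> xB; have z0 : 0 <= z x by exact: enorm_ge0.
rewrite -(mulr_powRB1 z0 q0) mulrC ler_wpM2r//; apply: ge0_ler_powR;
  rewrite ?nnegrE//.
- by case/andP: q12; rewrite subr_ge0.
- by rewrite mulr_ge0// ltW.
- exact: enorm_grad_diff_le.
Qed.

(** The coordinatewise estimates at one scale are summed, with |v|_2 <= |v|_1,
    and the exponent q is brought down to 1 by [powR_le_linear]. *)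
Lemma gap_pointwise (eta : K) : 0 < eta <= R -> {ae mu, forall x,
  ((z x `^ q)%:E <=
    ((2 * L) `^ (q - 1) / eta * d%:R)%:E *
      (phi x + conjugate phi (grad phibar x) - (dotv x (grad phibar x))%:E) +
    ((2 * L) `^ (q - 1) / eta * \sum_i (sdiff u i eta \_ (eball R)) x)%:E)%E}.
Proof.
move=> /andP[eta0 etaR].
move: ball_ae slope_ae; apply: filterS2 => x xB /(_ xB) sl.
set g := (phi x + _ - _)%E; have g0 : (0 <=
  g)%E by exact: (fenchel_gap_ge0 pphi).
set c := (2 * L) `^ (q - 1) / eta.
have c0 : 0 < c by rewrite divr_gt0// powR_gt0// mulr_gt0.
have cd : 0 < c * d%:R by rewrite mulr_gt0.
have coord i : ((eta * `|grad phibar x ord0 i - grad phi x ord0 i|)%:E <=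
    g + (sdiff u i eta x)%:E)%E.
  apply: coord_diff_le; first exact: ltW.
    move=> t te; apply: Lphi.1; apply: eball_shift => //;
      exact: le_trans te etaR.
  by move=> t te; apply: sl; exact: le_trans te etaR.
move: g0 coord; case: g => [r| |]//= => [r0 coord|_ _]; last first.
  by rewrite gt0_muley ?lte_fin// leey.
rewrite -EFinD lee_fin (le_trans (powR_le_linear xB))//.
rewrite -mulrA -mulrDr /c -mulrA ler_pM2l ?powR_gt0 ?mulr_gt0//
  mulrC ler_pdivlMr// mulrC.
apply: (@le_trans _ _ (\sum_i (eta * `|grad phibar x ord0 i - grad phi x ord0
  i|))).
  rewrite -mulr_sumr ler_pM2l// (le_trans (enorm_le_sum _))//.
  by apply: ler_sum => i _; rewrite !mxE.
apply: (@le_trans _ _ (\sum_(i < d) (r + sdiff u i eta x))).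
  by apply: ler_sum => i _; have := coord i; rewrite -EFinD lee_fin.
rewrite big_split/= sumr_const card_ord -[r *+ _]mulr_natl lerD2l.
by apply: ler_sum => i _; rewrite patchE mem_set.
Qed.

(** Each of the d second differences contributes its integral from
    [sdiff_integral_mu_le] to the integrated form of [gap_pointwise]. *)
Lemma gradient_stability_scale (eta : K) : 0 < eta <= R ->
  ('N[mu]_(q%:E)[EFin \o z] `^ q <=
     ((2 * L) `^ (q - 1) / eta * d%:R)%:E * gap mu phi phibar
     + ((2 * L) `^ (q - 1) * (2 * d%:R * M * L * A * eta))%:E)%E.
Proof.
move=> etaR; have [eta0 etaR'] := andP etaR.
have etaR0 : 0 <= eta <= R by rewrite ltW.
have c0 : 0 < (2 * L) `^ (q - 1) / eta by rewrite divr_gt0// powR_gt0//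
  mulr_gt0.
have mB := @measurable_eball K d R.
have mr i : measurable_fun setT (sdiff u i eta \_ (eball R)).
  apply/measurable_restrict => //; rewrite setTI; apply: measurable_funTS.
  exact: measurable_sdiff.
have r0 i x : 0 <= (sdiff u i eta \_ (eball R)) x.
  by rewrite patchE; case: ifPn => //; rewrite inE; exact: sdiff0.
rewrite poweR_Lnorm ?gt_eqF//.
have := nonneg_integral_le_affine (mu := mu) (h := fun x =>
  (z x `^ q)%:E) _ _ _ _ _ (gap_pointwise etaR).
move=> H.
have zE x : (`|(EFin \o z) x| `^ q)%E = (z x `^ q)%:E.
  by rewrite /= ger0_norm// enorm_ge0.
under eq_integral do rewrite zE.
apply: (le_trans (H _ _ _ _ _)).
- by rewrite mulr_gt0.
- by move=> x; rewrite lee_fin powR_ge0.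
- by move=> x; exact: (fenchel_gap_ge0 pphi).
- by move=> x; rewrite mulr_ge0 ?(ltW c0)// sumr_ge0.
- by apply: measurable_funM => //; apply: measurable_sum => i; exact: mr.
apply: leeD => //.
under eq_integral do rewrite EFinM -sumEFin.
rewrite ge0_integralZl//; last 3 first.
- by apply: emeasurable_sum => i; apply/measurable_EFinP; exact: mr.
- by move=> x _; apply: sume_ge0 => i _; rewrite lee_fin.
- by rewrite lee_fin ltW.
rewrite ge0_integral_sum//; last 2 first.
- by move=> i; apply/measurable_EFinP; exact: mr.
- by move=> i x _; rewrite lee_fin.
apply: (@le_trans _ _ (((2 * L) `^ (q - 1) / eta)%:E *
    \sum_(i < d) (M * (2 * L * eta ^+ 2 * A))%:E)%E).
  apply: lee_wpmul2l; first by rewrite lee_fin ltW.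
  apply: lee_sum => i _; apply: le_trans (sdiff_integral_mu_le i etaR0).
  rewrite [leRHS]integral_mkcond le_eqVlt; apply/orP; left; apply/eqP.
  by apply: eq_integral => x _; rewrite !patchE; case: ifP.
rewrite sumEFin sumr_const card_ord -EFinM lee_fin le_eqVlt; apply/orP; left;
  apply/eqP.
by rewrite -[(M * _) *+ _]mulr_natl; field; rewrite gt_eqF.
Qed.

End gradient_stability.

(** * Comparison of the constants *)

Section constants.
Context (K : realType) (R : K) (d : nat).
Hypotheses (R0 : 0 < R) (d0 : (0 < d)%N).

Let s : K := Num.sqrt (2 * pi / (d%:R + 2)).
Let d2 : 0 < d%:R + 2 :> K. Proof. by rewrite ltr_wpDl. Qed.
Let pi0 : 0 < pi :> K := pi_gt0 K.

Lemma gauss_massE : gauss_mass d R = R * s.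
Proof. by rewrite /gauss_mass sqrtrM ?sqr_ge0// sqrtr_sqr gtr0_norm. Qed.

Let s0 : 0 < s. Proof. by rewrite sqrtr_gt0 divr_gt0// mulr_gt0. Qed.

Let s_le2 : s <= 2.
Proof.
rewrite -[leRHS]ger0_norm// -sqrtr_sqr ler_sqrt ?sqr_ge0// ler_pdivrMr//.
have d1 : 1 <= d%:R :> K by rewrite ler1n.
by have := pihalf_lt2 K; lra.
Qed.

Let powR_halfE (a : K) : 0 <= a -> a `^ (d%:R / 2) = Num.sqrt a ^+ d.
Proof. by move=> a0; rewrite mulrC powRrM powR12_sqrt// powR_mulrn//
  sqrtr_ge0. Qed.

Let rootE : Num.sqrt (64 * pi * expR 1 / (d%:R / 2 + 1)) = 8 * expR 2^-1 *
  s :> K.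
Proof.
have -> : 64 * pi * expR 1 / (d%:R / 2 + 1) = (8 * expR 2^-1) ^+ 2 * (2 *
  pi / (d%:R + 2)) :> K.
  rewrite exprMn -expRM_natr mulVf ?pnatr_eq0//; field.
  by do ?[apply/andP; split]; apply/lt0r_neq0; have := d2; lra.
by rewrite sqrtrM ?sqr_ge0// sqrtr_sqr ger0_norm// mulr_ge0// expR_ge0.
Qed.

Let denE : Num.sqrt (2 * pi) * Num.sqrt (d%:R / 2 + 1) = Num.sqrt (pi * (d%:R +
  2)) :> K.
Proof. by rewrite -sqrtrM ?mulr_ge0 ?(ltW pi0)//; congr Num.sqrt; field. Qed.

Let s_ge : (d%:R + 2)^-1 <= s / Num.sqrt (pi * (d%:R + 2)).
Proof.
have p0 : 0 < pi * (d%:R + 2) :> K by rewrite mulr_gt0.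
rewrite ler_pdivlMr ?sqrtr_gt0//.
rewrite -ler_sqr ?nnegrE ?(ltW s0) ?mulr_ge0 ?sqrtr_ge0 ?invr_ge0 ?(ltW d2)//.
rewrite exprMn !sqr_sqrtr ?(ltW p0) ?divr_ge0 ?mulr_ge0 ?(ltW pi0) ?(ltW d2)//.
rewrite [leLHS](_ : _ = pi / (d%:R + 2)); last by field; rewrite gt_eqF.
by rewrite ler_pM2r ?invr_gt0//; have := pi0; lra.
Qed.

(** With s ^ 2 = 2 pi / (d + 2), the power in C_{R,d} is
    (8 e ^ (1 / 2) s) ^ d, since 64 pi e / (d / 2 + 1) = 64 e s ^ 2.  Dividing by
    d ^ 2 times the slice constant leaves
    192 * 8 ^ d * 2 ^ (d - 1) * s / sqrt (pi (d + 2)), and the last quotient is at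
    least 1 / (d + 2). *)
Lemma slice_const_le_C : 16 * d%:R ^+ 2 * slice_const d R <= C_ R d.
Proof.
have [k dk] : exists k, d = k.+1 by case: d d0 => // k _; exists k.
rewrite /C_ /slice_const gauss_massE denE powR_halfE; last first.
  apply: divr_ge0; last by have := d2; lra.
  by apply: mulr_ge0; [rewrite mulr_ge0// ltW|exact: expR_ge0].
rewrite rootE !exprMn -expRM_natr [expR ((d%:R + 2) / 2)](_ : _ = expR 1 *
  expR (2^-1 * d%:R)); last first.
  by rewrite -expRD; congr expR; field.
set E := expR (2^-1 * d%:R); set e := expR 1.
have E0 : 0 < E := expR_gt0 _; have e0 : 0 < e := expR_gt0 _.
have -> : s ^+ d = s ^+ d.-1 * s by rewrite dk exprSr.
set S := s ^+ d.-1; set Rd := R ^+ d.-1.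
have S0 : 0 < S by rewrite exprn_gt0.
have Rd0 : 0 < Rd by rewrite exprn_gt0.
set P := d%:R ^+ 2 * (e * E * (Rd * S)).
have P0 : 0 <= P by rewrite mulr_ge0 ?sqr_ge0// !mulr_ge0// ltW.
rewrite [leLHS](_ : _ = P * 16); last by rewrite /P; ring.
rewrite [leRHS](_ : _ = P * (192 * 8 ^+ d * 2 ^+ d.-1 * (s / Num.sqrt (pi *
  (d%:R + 2))))); last first.
  by rewrite /P; field; rewrite gt_eqF// sqrtr_gt0 mulr_gt0.
rewrite ler_wpM2l//.
have h8 : d%:R + 2 <= 8 ^+ d :> K.
  rewrite dk; elim: (k) => [|n IHn]; first by rewrite expr1; lra.
  have h1 : 1 <= n.+1%:R :> K by rewrite ler1n.
  by rewrite exprS -[n.+2%:R]natr1; lra.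
have h2 : 1 <= 2 ^+ d.-1 :> K by rewrite exprn_ege1// ler1n.
have : 192 * (d%:R + 2) * 1 * (d%:R + 2)^-1 <= 192 * 8 ^+ d * 2 ^+ d.-1 *
  (s / Num.sqrt (pi * (d%:R + 2))).
  apply: ler_pM => //; rewrite ?mulr1 ?mulr_ge0 ?invr_ge0 ?(ltW d2)//.
  rewrite -[leLHS]mulr1; apply: ler_pM => //; rewrite ?mulr_ge0 ?(ltW d2)//.
  by rewrite ler_pM2l.
rewrite mulr1 -mulrA divff ?gt_eqF// => /(le_trans _); apply.
by rewrite mulr1; lra.
Qed.

(** The measure of the ball is 1, and it is at most M times its volume, which
    is bounded by the slice constant times one more Gaussian factor R s <= 2 R. *)
Lemma density_lower_bound (M : K) (mu : probability 'rV[K]_d K) : 0 < M ->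
  has_density_le mu M -> mu (~` eball R) = 0%E ->
  2^-1 <= M * slice_const d R * R.
Proof.
move=> M0 muM muR.
have mB := @measurable_eball K d R.
have mB1 : mu (eball R) = 1%E.
  by have := probability_setC mu (measurableC mB); rewrite setCK muR sube0.
have h : (1 <= M%:E * lebesgue_rV K d (eball R))%E.
  by rewrite -mB1; exact: (has_density_measure_le (ltW M0) muM mB).
have ME0 : (0 <= M%:E)%E by rewrite lee_fin ltW.
have := le_trans h (lee_wpmul2l ME0 (lebesgue_eball_le d R0)).
rewrite -EFinM lee_fin.
have -> : gauss_mass d R ^+ d = gauss_mass d R ^+ d.-1 * (R * s).
  by rewrite -gauss_massE -exprSr prednK.
rewrite !mulrA -(mulrA M) -/(slice_const d R) => h1.
have X0 : 0 <= M * slice_const d R * R by rewrite mulr_ge0 ?(ltW R0)//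
  mulr_ge0 ?slice_const_ge0// ltW.
have := ler_wpM2l X0 s_le2; lra.
Qed.

End constants.

(** * Choice of the scale *)

Lemma poweR_le_root (K : realType) (N : \bar K) (c q : K) : 0 < q -> 0 <= c ->
  (0 <= N)%E -> (N `^ q <= (c `^ q)%:E)%E -> (N <= c%:E)%E.
Proof.
move=> q0 c0 N0 h.
rewrite -[leLHS]poweRe1// -[leRHS]poweRe1 ?lee_fin// -(@divff _ q) ?gt_eqF//
  !poweRrM.
apply: gt0_ler_poweR; first by rewrite invr_ge0 ltW.
- by rewrite in_itv/= poweR_ge0 leey.
- by rewrite poweR_EFin in_itv/= lee_fin powR_ge0 leey.
- by rewrite poweR_EFin.
Qed.

Lemma Lnorm_le_cst (K : realType) d (mu : probability 'rV[K]_d K) (z : 'rV[K]_d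
  -> K)
    (q c : K) : 0 < q -> 0 <= c -> (forall x, 0 <= z x) ->
  {ae mu, forall x, z x <= c} -> ('N[mu]_(q%:E)[EFin \o z] <= c%:E)%E.
Proof.
move=> q0 c0 z0 zc; apply: (poweR_le_root q0 c0); first exact: Lnorm_ge0.
rewrite poweR_Lnorm ?gt_eqF//.
have H := @nonneg_integral_le_affine _ _ K mu (fun x =>
  (z x `^ q)%:E) (cst 0%E) (cst (c `^ q)) 1.
rewrite (_ : (fun x => _) = (fun x => (z x `^ q)%:E)); last first.
  by apply/funext => x; rewrite /= ger0_norm.
apply: (le_trans (H _ _ _ _ _ _)) => //.
- by move=> x; rewrite lee_fin powR_ge0.
- by move=> x; exact: powR_ge0.
- apply: filterS zc => x zx; rewrite mule0 add0e lee_fin.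
  by rewrite ge0_ler_powR ?nnegrE// ltW.
- by rewrite integral0 mule0 add0e -[leLHS]/(\int[mu]_x (cst (c `^ q)%:E x))%E
    integral_cst// [X in (_ * X)%E]probability_setT mule1.
Qed.

(** Here C stands for M C_{R,d}.  As (q + 3) / (q + 1) = 1 + 2 / (q + 1), the
    threshold is (R / 8) (2 L) (C R / 8) ^ (2 / (q + 1)) >= R L / 4, and a gap of
    R L / 4 makes the right-hand side equal to 2 L. *)
Lemma large_gap_bound (K : realType) (R L q C : K) (G : \bar K) :
  0 < R -> 0 < L -> 1 <= q -> 8 <= C * R ->
  (((R / 8) `^ ((q + 3) / (q + 1)) * (2 * L) * C `^ (2 / (q + 1)))%:E < G)%E ->
  ((2 * L)%:E <= (4 * Num.sqrt (L / R))%:E * G `^ (1 / 2))%E.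
Proof.
move=> R0 L0 q1 CR hG.
have R8 : 0 < R / 8 by rewrite divr_gt0.
have C0 : 0 < C by rewrite -(pmulr_lgt0 _ R0) (lt_le_trans _ CR).
have e0 : 0 <= 2 / (q + 1) by rewrite divr_ge0//; lra.
have thr : R * L / 4 <= (R / 8) `^ ((q + 3) / (q + 1)) * (2 * L) *
  C `^ (2 / (q + 1)).
  rewrite (_ : (q + 3) / (q + 1) = 1 + 2 / (q + 1)); last first.
    by field; rewrite gt_eqF//; lra.
  rewrite powRD; last by rewrite (gt_eqF R8) implybT.
  rewrite powRr1 ?(ltW R8)//.
  have h1 : 1 <= (R / 8) `^ (2 / (q + 1)) * C `^ (2 / (q + 1)).
    rewrite -powRM ?(ltW R8) ?(ltW C0)//.
    apply: (@le_trans _ _ (1 `^ (2 / (q + 1)))); first by rewrite powR1.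
    by apply: ge0_ler_powR; rewrite ?nnegrE ?mulr_ge0 ?(ltW R8) ?(ltW C0)//;
      lra.
  have RL0 : 0 <= R / 8 * (2 * L) by rewrite !mulr_ge0// ?invr_ge0 ltW.
  by have := ler_wpM2l RL0 h1; lra.
have RL4 : 0 < R * L / 4 by rewrite divr_gt0// mulr_gt0.
have sL : 0 <= 4 * Num.sqrt (L / R) by rewrite mulr_ge0// sqrtr_ge0.
(* At G = R L / 4 the bound is 2 L, as L / R * (R * L / 4) = (L / 2) ^ 2. *)
apply: (@le_trans _ _ ((4 * Num.sqrt (L / R))%:E * (R *
  L / 4)%:E `^ (1 / 2))%E); last first.
  apply: lee_wpmul2l; first by rewrite lee_fin.
  have h : ((R * L / 4)%:E <= G)%E by apply: le_trans (ltW hG); rewrite lee_fin.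
  apply: gt0_ler_poweR => //; rewrite ?in_itv/= ?leey ?andbT ?lee_fin ?(ltW
    RL4)//.
  by apply: le_trans h; rewrite lee_fin ltW.
rewrite poweR_EFin -EFinM lee_fin div1r powR12_sqrt ?(ltW RL4)//.
rewrite -(mulrA 4) -sqrtrM ?divr_ge0 ?(ltW L0) ?(ltW R0)//.
rewrite (_ : L / R * (R * L / 4) = (L / 2) ^+ 2); last by field; rewrite gt_eqF.
by rewrite sqrtr_sqr ger0_norm ?divr_ge0 ?(ltW L0)//; lra.
Qed.

(** Here C stands for M C_{R,d}, and d b <= C expresses that the slice constant
    is small compared with it.  With w = C r / L the claim reads
    N <= 4 L w ^ (1 / (q + 3)).  It follows from N <= 2 L when w >= 1 / 16, because
    q + 3 >= 4.  Otherwise eta = d sqrt w / C makes each of the two terms of the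
    bound at scale eta at most L sqrt w (up to the common factor), and
    w ^ (1 / 2) <= w ^ (q / (q + 3)) because w <= 1 and q <= 3. *)
Lemma small_gap_bound (K : realType) (R L q C b d r : K) (N : \bar K) :
  0 < R -> 0 < L -> 1 <= q <= 2 -> 0 <= r -> 1 <= d ->
  0 <= b -> d * b <= C -> d <= C * R -> (0 <= N)%E -> (N <= (2 * L)%:E)%E ->
  (forall eta, 0 < eta <= R -> (N `^ q <=
     ((2 * L) `^ (q - 1) / eta * d)%:E * r%:E + ((2 * L) `^ (q - 1) * (b * L *
       eta))%:E)%E) ->
  (N <= (4 * (L `^ (q + 2) * C) `^ (1 / (q + 3)))%:E * r%:E `^ (1 / (q + 3)))%E.
Proof.
move=> R0 L0 /andP[q1 q2] r0 d1 b0 bC dC N0 N2L H.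
have q0 : 0 < q by lra.
have C0 : 0 < C by rewrite -(pmulr_lgt0 _ R0); lra.
have L20 : 0 < 2 * L by rewrite mulr_gt0.
have Lq0 : 0 < (2 * L) `^ (q - 1) by rewrite powR_gt0.
pose w := C * r / L; have w0 : 0 <= w by rewrite divr_ge0 ?mulr_ge0 ?(ltW C0)
  ?(ltW L0).
have q30 : 0 < q + 3 by lra.
rewrite poweR_EFin -EFinM -mulrA -powRM ?mulr_ge0 ?powR_ge0 ?(ltW C0)//.
have -> : L `^ (q + 2) * C * r = L `^ (q + 3) * w.
  rewrite (_ : q + 3 = (q + 2) + 1); last by ring.
  rewrite [in RHS]powRD; last by rewrite (gt_eqF L0) implybT.
  by rewrite powRr1 ?(ltW L0)// /w; field; rewrite gt_eqF.
rewrite powRM ?powR_ge0// -powRrM [(q + 3) * _]mulrC mul1r mulVf ?gt_eqF//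
  powRr1 ?(ltW L0)//.
have [w16|w16] := leP (1 / 16) w.
  apply: le_trans N2L _; rewrite lee_fin.
  suff : 2^-1 <= w `^ (q + 3)^-1 by move=> /(ler_wpM2l (ltW L0)); lra.
  have -> : 2^-1 = (1 / 16) `^ 4^-1 :> K.
    rewrite (_ : 1 / 16 = 2^-1 `^ 4 :> K); last by rewrite powR_mulrn//; field.
    by rewrite -powRrM divff ?powRr1// ?invr_ge0// pnatr_eq0.
  apply: (@le_trans _ _ ((1 / 16) `^ (q + 3)^-1)).
    by apply: ger_powR; [lra|rewrite lef_pV2 ?posrE//; lra].
  by apply: ge0_ler_powR; rewrite ?nnegrE ?invr_ge0 ?(ltW q30)//; lra.
have sq : (N `^ q <= ((2 * L) `^ q * Num.sqrt w)%:E)%E.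
  have [we0|wn0] := eqVneq w 0.
    have re0 : r = 0.
      apply/eqP; move/eqP: we0; rewrite /w mulf_eq0 invr_eq0 (gt_eqF L0) orbF.
      by rewrite mulf_eq0 (gt_eqF C0).
    (* For w = 0 the optimal scale degenerates, and eta tends to 0 instead. *)
    rewrite we0 sqrtr0 mulr0; apply/lee_addgt0Pr => e e0; rewrite add0e.
    pose c := (2 * L) `^ (q - 1) * (b * L).
    have c0 : 0 <= c by rewrite mulr_ge0 ?(ltW Lq0)// mulr_ge0// ltW.
    have c1 : 0 < c + 1 by rewrite ltr_wpDl.
    have etaR : 0 < Num.min R (e / (c + 1)) <= R.
      by rewrite lt_min R0 divr_gt0//= ge_min lexx.
    apply: le_trans (H _ etaR) _; rewrite re0 mule0 add0e lee_fin mulrA -/c.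
    apply: (@le_trans _ _ (c * (e / (c + 1)))).
      by rewrite ler_wpM2l// ge_min lexx orbT.
    by rewrite mulrA ler_pdivrMr// mulrC ler_pM2l// lerDl.
  have wp : 0 < w by rewrite lt0r wn0.
  have sw0 : 0 < Num.sqrt w by rewrite sqrtr_gt0.
  have sw2 : Num.sqrt w * Num.sqrt w = w by rewrite -expr2 sqr_sqrtr.
  have sw1 : Num.sqrt w <= 1 by rewrite -[leRHS]sqrtr1 ler_sqrt//; lra.
  (* This scale balances d r / eta against L C eta / d, which dominates
     b L eta. *)
  pose eta := d * Num.sqrt w / C.
  have d0 : 0 < d by lra.
  have eta0 : 0 < eta by rewrite divr_gt0// mulr_gt0.
  have etaR : 0 < eta <= R.
    rewrite eta0 ler_pdivrMr// [R * C]mulrC; apply: le_trans dC.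
    by rewrite ler_piMr// ltW.
  apply: le_trans (H _ etaR) _; rewrite -EFinM -EFinD lee_fin.
  rewrite -(mulr_powRB1 (ltW L20) q0).
  have h1 : d / eta * r = L * Num.sqrt w.
    have -> : r = w * L / C by rewrite /w; field;
      rewrite (gt_eqF C0) (gt_eqF L0).
    by rewrite -[X in X * L / C]sw2 /eta; field;
      rewrite (gt_eqF C0) (gt_eqF sw0) (gt_eqF d0).
  have h2 : b * L * eta <= L * Num.sqrt w.
    rewrite /eta mulrA ler_pdivrMr//.
    rewrite [leLHS](_ : _ = L * Num.sqrt w * (d * b)); last by ring.
    by rewrite ler_wpM2l// mulr_ge0// ltW.
  rewrite [leLHS](_ : _ = (2 * L) `^ (q - 1) * (d / eta * r + b * L * eta));
    last first.
    by field; rewrite gt_eqF.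
  by rewrite h1 [leRHS]mulrAC mulrC -mulrA ler_wpM2r ?(ltW Lq0)//; lra.
apply: (poweR_le_root q0) => //.
  by rewrite mulr_ge0// mulr_ge0 ?powR_ge0// ltW.
apply: le_trans sq _; rewrite lee_fin mulrA [in leRHS]powRM ?powR_ge0 ?mulr_ge0
  ?(ltW L0)//.
apply: ler_pM; rewrite ?powR_ge0 ?sqrtr_ge0//.
  by apply: ge0_ler_powR; rewrite ?nnegrE ?mulr_ge0 ?(ltW L0) ?(ltW q0)//; lra.
have [->|wn0] := eqVneq w 0; first by rewrite sqrtr0 powR_ge0.
rewrite -powR12_sqrt// -powRrM; apply: ger_powR;
  first by rewrite lt0r wn0 w0/=; lra.
by rewrite mulrC ler_pdivrMr//; lra.
Qed.

(** * Conclusion *)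

Theorem theorem4p4 (K : realType) (d : nat) (R L M q : K)
    (mu : probability 'rV[K]_d K) (phibar phi : 'rV[K]_d -> \bar K) :
  (0 < d)%N -> 0 < R -> 0 < L -> 0 < M ->
  has_density_le mu M ->
  compact (msupport mu) -> msupport mu `<=` eball R ->
  convex_lsc phibar -> convex_lsc phi ->
  lipschitz_on_eball phibar (2 * R) L -> lipschitz_on_eball phi (2 * R) L ->
  1 <= q <= 2 ->
  let G := gap mu phi phibar in
  let N := 'N[mu]_(q%:E)[EFin \o (fun x => enorm (grad phibar x - grad phi x)%R)]%E in
  let threshold :=
    (R / 8) `^ ((q + 3) / (q + 1)) * (2 * L) * (M * C_ R d) `^ (2 / (q + 1)) in
  ((threshold%:E < G)%E ->
    (N <= (4 * Num.sqrt (L / R))%:E * G `^ (1 / 2)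
        + L%:E * ((32 / (R * L))%:E * G) `^ ((q + 1) / (2 * q)))%E) /\
  (~ (threshold%:E < G)%E ->
    (N <= (4 * (L `^ (q + 2) * M * C_ R d) `^ (1 / (q + 3)))%:E
        * G `^ (1 / (q + 3)))%E).
Proof.
case: d mu phibar phi => [//|k] mu phibar phi _ R0 L0 M0 muM _ suppR _ Cphi
  Lbar Lphi q12.
set G := gap mu phi phibar => /=; set N := 'N[mu]_(q%:E)[_]%E.
have q0 : 0 < q by case/andP: q12 => /(lt_le_trans ltr01).
pose A := slice_const k.+1 R; pose n : K := k.+1%:R; pose C := M * C_ R k.+1.
have muR : mu (~` eball R) = 0%E by apply: msupport_null => //;
  exact: measurable_eball.
have n1 : 1 <= n by rewrite ler1n.
have A0 : 0 <= A by exact: slice_const_ge0.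
have AC : 16 * n ^+ 2 * (M * A) <= C.
  rewrite mulrCA; apply: ler_wpM2l; first exact: ltW.
  exact: slice_const_le_C.
have MAR : 2^-1 <= M * A * R by exact: density_lower_bound muR.
have CR : 8 * n ^+ 2 <= C * R.
  apply: le_trans (ler_wpM2r (ltW R0) AC).
  by have := ler_wpM2l (sqr_ge0 n) MAR; lra.
have nn : n <= n ^+ 2 by rewrite expr2 ler_peMl//; lra.
have G0 : (0 <= G)%E.
  by apply: integral_ge0 => x _; apply: fenchel_gap_ge0; case: Cphi.
have N0 : (0 <= N)%E by exact: Lnorm_ge0.
have N2L : (N <= (2 * L)%:E)%E.
  apply: Lnorm_le_cst => //; first by rewrite mulr_ge0// ltW.
    by move=> x; exact: enorm_ge0.
  exists (~` eball R); split => //; first by apply: measurableC;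
    exact: measurable_eball.
  by move=> x /= nle xB; apply: nle; exact: (enorm_grad_diff_le R0 L0 Lbar
    Lphi).
split=> [hG|hG].
  rewrite (le_trans N2L)//.
  have h1 : ((2 * L)%:E <= (4 * Num.sqrt (L / R))%:E * G `^ (1 / 2))%E.
    apply: (large_gap_bound R0 L0 _ _ hG); first by case/andP: q12.
    by rewrite -/C; lra.
  rewrite (le_trans h1)// leeDl// mule_ge0 ?poweR_ge0// lee_fin ltW//.
have [r rE] : exists r, G = r%:E.
  move: hG G0; case: (G) => [r _ _|hG _|//]; first by exists r.
  by exfalso; apply: hG; rewrite ltry.
have r0 : 0 <= r by rewrite -lee_fin -rE.
rewrite rE -(mulrA (L `^ _)) -/C.
apply: (@small_gap_bound _ R L q C (2 * n * M * A) n) => //.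
- by rewrite mulr_ge0// mulr_ge0 ?(ltW M0)// mulr_ge0//; lra.
- have : 0 <= M * A * n ^+ 2 by rewrite mulr_ge0 ?sqr_ge0// mulr_ge0// ltW.
  by move: AC; lra.
- lra.
move=> eta etaR; rewrite -rE.
have := gradient_stability_scale R0 L0 M0 muM muR Cphi Lbar Lphi q12 etaR.
by rewrite -/A -/n -/N -/G (_ : 2 * n * M * L * A * eta = 2 * n * M * A * L *
  eta)//; ring.
Qed.
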